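(* Let $R$ be a commutative ring with unit, $\delta\in R$, and $n\ge 1$. With the datum $(\Lambda,G,M,C,* )$ given in the context, the Brauer algebra $\mathrm{Br}_n(\delta)$ is diagram-like. In particular, given elements $C_{p_1,q_1}^{\sigma_1}$ associated to $t_1 \in \Lambda$ and $C_{p_2,q_2}^{\sigma_2}$ associated to $t_2 \in \Lambda$, we have $$C_{p_1,q_1}^{\sigma_1} C_{p_2,q_2}^{\sigma_2} = \delta^i C_{p,q}^{\sigma},$$ where (i) $i$ is the number of loops in the pair graph $\Gamma_{\langle q_1, p_2 \rangle}$, and (ii) the element $t \in \Lambda$ associated to $C_{p,q}^{\sigma}$ is equal to $t_2$ if and only if the cardinality of the pair-set $S_{\langle q_1, p_2 \rangle}$ is $t_2$.
   Context: Diagram-like: an associative unital $R$-algebra $A$ with datum $(\Lambda,G,M,C,* )$ such that: (W1) $\Lambda$ is a poset; for each $\lambda\in\Lambda$, $G(\lambda)$ is a group and $M(\lambda)$ a finite set, such that the map $\coprod_{\lambda} M(\lambda)\times G(\lambda)\times M(\lambda)\to A$, $(p,\sigma,q)\mapsto C_{p,q}^{\sigma}$, is injective with image an $R$-basis of $A$ (such a $C_{p,q}^\sigma$ is said to be associated to $\lambda$). (W2) $*$ is an $R$-linear anti-involution of $A$ with $(C_{p,q}^{\sigma})^*=C_{q,p}^{\sigma^{-1}}$. (DL) For any $\lambda_1,\lambda_2\in\Lambda$, $\sigma_i\in G(\lambda_i)$, $p_i,q_i\in M(\lambda_i)$ ($i=1,2$), we have $C_{p_1,q_1}^{\sigma_1}C_{p_2,q_2}^{\sigma_2}=\kappa\,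 C_{p,q}^{\sigma}$, where $\kappa\in R$ and $p,q,\sigma$ are given functions of the data on the left, such that, writing $\lambda$ for the element with $p,q\in M(\lambda)$, $\sigma\in G(\lambda)$: (1) $\lambda\le\lambda_1$ and $\lambda\le\lambda_2$; (2) $\lambda$ and $\kappa$ depend only on $q_1$ and $p_2$; (3) $\sigma$ depends only on $\sigma_1,q_1,p_2,\sigma_2$; (4) $p$ depends only on $p_1,\sigma_1,q_1,p_2$; (5) if $\lambda=\lambda_2$, then $q=q_2$, and $\sigma\sigma_2^{-1}$ depends only on $\sigma_1,q_1,p_2$. Brauer algebra: write $\underline n=\{1,\dots,n\}$, $\underline n'=\{1',\dots,n'\}$. $\mathrm{Br}_n(\delta)$ is the free $R$-module on partitions of $\underline n\cup\underline n'$ into parts of size 2 (diagrams; vertices in the same part are joined by an edge; $\underline n$ is on the left and $\underline n'$ on the right). The product $xy$ of diagrams is obtained by concatenation: identify each vertex $i'$ of $x$ with the vertex $i$ of $y$, delete the closed loops in the middle (say there are $k$ of them), and record how the outer vertices are joined, giving a diagram $z$; then $xy=\delta^k z$. Datum: $\Lambda=\{t\in\{0,1,\dots,n\}: n-t\text{ even}\}$ with the usual order. $G(t)=\Sigma_t$ is the symmetric group on $t$ letters ($\Sigma_0$ trivial). $M(t)$ is the set of Brauer link states on $\underline n$ with $t$ defects: partitions of $\underline n$ into parts of size 1 or 2 with exactly $t$ parts of size 1 (the defects, identified with their elements). For $p,q\in M(t)$, $\sigma\in\Sigma_t$, $C_{p,q}^{\sigma}$ is the diagram whose parts are: the 2-element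 parts of $p$; the 2-element parts of $q$ with all elements primed; and, for each $i\in\{1,\dots,t\}$, the pair consisting of the $i$-th defect of $q$ (primed) and the $\sigma(i)$-th defect of $p$ (defects ordered by the usual order). $*$ is the linear map induced by interchanging $i\leftrightarrow i'$ for all $i$. Pair graph and pair set: for Brauer link states $q,p$, $\Gamma_{\langle q,p\rangle}$ is the graph (multigraph) with vertex set $\underline n$, one edge for each 2-element part of $q$ and one edge for each 2-element part of $p$ (so a part common to both gives a double edge). Its loops are its cyclic connected components. $S_{\langle q,p\rangle}\subset\pi_0(\Gamma_{\langle q,p\rangle})$ is the set of path components containing both a defect of $q$ and a defect of $p$. *)

(* Defs.v *)
From HB Require Import structures.
From mathcomp Require Import all_boot all_order all_fingroup all_algebra zify.

Set Implicit Arguments.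
Unset Strict Implicit.
Unset Printing Implicit Defensive.

Import Order.TTheory GRing.Theory.

(* Two involutions f and g without common fixed point generate a dihedral action:
   an orbit containing a fixed point of f or g contains exactly two of them. *)
Section Dihedral.
Variables (V : finType) (f g : V -> V).
Hypotheses (fK : involutive f) (gK : involutive g).
Hypothesis nofix : forall v, ~~ ((f v == v) && (g v == v)).
Let e : rel V := fun a b => (b == f a) || (b == g a).

Lemma dihedral_ends u : g u = u ->
  exists2 w, w != u &
    forall v, (connect e u v && ((f v == v) || (g v == v))) = (v \in [:: u; w]).
Proof.
move=> gu; pose h v := g (f v).
have hinj : injective h by move=> a b /(inv_inj gK)/(inv_inj fK).
pose m := fingraph.order h u; pose p k := iter k h u.
have hf a : h (f (h a)) = f a by rewrite /h fK gK.
have pm : p m = u by rewrite /p iter_order.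
have gpk k j : k + j = m -> g (p k) = p j.
  elim: k j => [|k IH] j; first by rewrite add0n => ->; rewrite pm.
  rewrite addSnnS => /IH; rewrite /p /= => gk.
  by rewrite {1}/h gK; apply: hinj; rewrite -gk /h fK.
have fpk k j : (k + j).+1 = m -> f (p k) = p j.
  move=> kjm; apply: (inv_inj gK); rewrite (gpk j k.+1) ?addnS 1?addnC //.
have m_gt0 : 0 < m by apply: fingraph.order_gt0.
have pinj i j : i < m -> j < m -> (p i == p j) = (i == j).
  move=> im jm; apply/eqP/eqP => [eq|->//].
  by rewrite -(findex_iter im) -(findex_iter jm) [iter i _ _]eq.
have gfix k : k < m -> (g (p k) == p k) = (k == 0) || (k.*2 == m).
  case: k => [|k] km; first by rewrite /p /= gu eqxx.
  by rewrite (gpk k.+1 (m - k.+1)) ?pinj; lia.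
have ffix k : k < m -> (f (p k) == p k) = (k.*2.+1 == m).
  by move=> km; rewrite (fpk k (m - k.+1)) ?pinj; lia.
have m_gt1 : 1 < m.
  case: (ltngtP m 1) => // m1; first by lia.
  by have := nofix u; rewrite gu eqxx andbT (ffix 0) ?m1.
have conn v : connect e u v = (v \in fingraph.orbit h u).
  apply/idP/idP; last first.
    rewrite -fconnect_orbit; apply: connect_sub => a _ /eqP<-.
    apply: (connect_trans (y := f a)); apply: connect1; rewrite /e /h ?eqxx //.
    by rewrite orbT.
  case/connectP=> q; elim/last_ind: q v => [|q a IH] v /=; first by move=> _ ->; apply: in_orbit.
  rewrite rcons_path last_rcons => /andP[/IH-/(_ _ erefl) + ea] ->.
  rewrite -!fconnect_orbit => ul; have lm := findex_max ul.
  move: ea; rewrite -(iter_findex ul); set k := findex _ _ _ in lm *.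
  case/orP=> /eqP->.
    by rewrite (fpk k (m - k.+1)) ?fconnect_iter //; lia.
  by rewrite (gpk k (m - k)) ?fconnect_iter //; rewrite -/m in lm; lia.
exists (p m./2) => [|v].
  have -> : u = p 0 by []. rewrite pinj; lia.
rewrite conn; case: (boolP (v \in fingraph.orbit h u)) => [uv|].
  rewrite -fconnect_orbit in uv; have lm := findex_max uv.
  rewrite -(iter_findex uv); set k := findex _ _ _ in lm *.
  rewrite -/m in lm; rewrite -/(p k) gfix ?ffix // !inE.
  have -> : (p k == u) = (p k == p 0) by [].
  by rewrite !pinj; lia.
move=> nuv; apply/esym/negbTE; apply: contra nuv; rewrite !inE => /orP[]/eqP->.
  exact: in_orbit.
by rewrite -fconnect_orbit fconnect_iter.
Qed.
End Dihedral.

(* The graph e on V is covered by e1 (embedded by i) and by edges between vertices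
   of V'; e' is obtained from e by contracting the vertices outside the image of j. *)
Section Contract.
Variables (V V1 V' : finType) (e : rel V) (e1 : rel V1) (e' : rel V').
Variables (i : V1 -> V) (j : V' -> V).
Hypotheses (iI : injective i) (jI : injective j).
Hypotheses (e1s : connect_sym e1) (e's : connect_sym e') (es : connect_sym e).
Hypothesis h1 : forall a b, e1 a b -> e (i a) (i b).
Hypothesis h2 : forall a b, e a b ->
  (exists a1 b1, [/\ a = i a1, b = i b1 & e1 a1 b1]) \/
  (exists a' b', [/\ a = j a', b = j b' & connect e' a' b']).
Hypothesis h3 : forall a1 b1 a' b', i a1 = j a' -> i b1 = j b' ->
  connect e1 a1 b1 -> connect e' a' b'.
Hypothesis h4 : forall a b, e' a b -> connect e (j a) (j b).
Hypothesis h5 : forall a, a \notin codom j -> a \in codom i.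

Lemma connect_homo (U W : finType) (r : rel U) (s : rel W) (k : U -> W) :
  (forall a b, r a b -> connect s (k a) (k b)) ->
  forall a b, connect r a b -> connect s (k a) (k b).
Proof.
move=> h a b /connectP[q]; elim: q a => [|c q IH] a /= => [_ ->//|/andP[ac cq] bE].
by apply: connect_trans (h _ _ ac) _; apply: IH.
Qed.

Lemma contract_connect a b : connect e' a b = connect e (j a) (j b).
Proof.
apply/idP/idP; first exact: connect_homo.
suff inv c : connect e (j a) c -> exists2 w, connect e' a w &
    c = j w \/ exists w1 c1, [/\ j w = i w1, c = i c1 & connect e1 w1 c1].
  case/inv=> w aw [/jI->//|[w1 [c1 [jw jb wc]]]].
  by apply: connect_trans aw _; apply: h3 wc.
case/connectP=> q; elim/last_ind: q c => [|q d IH] c /=.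
  by move=> _ ->; exists a => //; left.
rewrite rcons_path last_rcons => /andP[/IH-/(_ _ erefl)[w aw wl] ed] ->.
case: (h2 ed) => [[a1 [b1 [la -> ab]]]|[a' [b' [la -> ab]]]].
  exists w => //; right; case: wl => [wl|[w1 [c1 [jw lc wc]]]].
    by exists a1, b1; rewrite -wl la; split=> //; apply: connect1.
  exists w1, b1; split=> //; apply: connect_trans wc (connect1 _).
  by rewrite (_ : c1 = a1) //; apply: iI; rewrite -lc.
case: wl => [wl|[w1 [c1 [jw lc wc]]]].
  by exists b'; [apply: connect_trans aw _; rewrite (jI (etrans (esym wl) la))|left].
exists b'; last by left.
by apply: connect_trans aw (connect_trans _ ab); apply: h3 wc; rewrite -?lc.
Qed.

Lemma contract_lift u1 :
  (forall b1, connect e1 u1 b1 -> i b1 \notin codom j) ->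
  forall b, connect e (i u1) b -> exists2 b1, b = i b1 & connect e1 u1 b1.
Proof.
move=> uH b /connectP[q]; elim/last_ind: q b => [|q d IH] b /=.
  by move=> _ ->; exists u1.
rewrite rcons_path last_rcons => /andP[pq ed] ->.
have [b1 lb ub] := IH _ pq erefl.
case: (h2 ed) => [[a1 [d1 [la -> ad]]]|[a' [b' [la _ _]]]].
  exists d1 => //; apply: connect_trans ub (connect1 _).
  by rewrite (_ : b1 = a1) //; apply: iI; rewrite -lb.
by have := uH _ ub; rewrite -lb la codom_f.
Qed.

Definition inner (U : finType) (r : rel U) (I : {set U}) :=
  [set K in equivalence_partition (connect r) [set: U] | K \subset I].

Lemma innerP (U : finType) (r : rel U) (I K : {set U}) :
  reflect (exists2 u, K = [set v | connect r u v] & forall v, connect r u v -> v \in I)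
   (K \in inner r I).
Proof.
rewrite inE; apply: (iffP andP) => [[/imsetP[u _ ->] sI]|[u -> sI]].
  exists u; first by apply/setP=> v; rewrite !inE.
  by move=> v uv; apply: (subsetP sI); rewrite !inE.
split; last by apply/subsetP=> v; rewrite inE; apply: sI.
by apply/imsetP; exists u => //; apply/setP=> v; rewrite !inE.
Qed.

Lemma contract_inner (I' : {set V'}) (H1 : {set V1}) (I : {set V}) :
  (forall a, (a \in H1) = (i a \notin codom j)) ->
  (forall a, a \notin codom j -> a \in I) ->
  (forall a, (j a \in I) = (a \in I')) ->
  #|inner e I| = #|inner e1 H1| + #|inner e' I'|.
Proof.
move=> H1E HI I'E.
pose H := [set a | a \notin codom j].
rewrite -(cardsID (inner e H)); congr (_ + _).
  have -> : inner e I :&: inner e H = [set i @: K | K : {set V1} in inner e1 H1].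
    apply/setP=> K; rewrite inE; apply/andP/imsetP.
      case=> _ /innerP[u defK uH].
      have /h5/codomP[u1 uE] : u \notin codom j by have := uH u (connect0 _ _); rewrite inE.
      subst u.
      have up b1 : connect e1 u1 b1 -> connect e (i u1) (i b1).
        by apply: connect_homo => a b /h1; apply: connect1.
      have uH1 b1 : connect e1 u1 b1 -> i b1 \notin codom j.
        by move/up/uH; rewrite inE.
      have step := contract_lift uH1.
      exists [set b1 | connect e1 u1 b1].
        by apply/innerP; exists u1 => // b1 /up/uH; rewrite inE H1E.
      rewrite defK; apply/setP=> b; rewrite inE; apply/idP/imsetP.
        by case/step=> b1 -> ub; exists b1; rewrite ?inE.
      by case=> b1; rewrite inE => /up ub ->.
    case=> _ /innerP[u1 -> uH] ->.
    have step := contract_lift (fun b1 ub => etrans (esym (H1E b1)) (uH b1 ub)).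
    have KE : i @: [set v | connect e1 u1 v] = [set b | connect e (i u1) b].
      apply/setP=> b; rewrite inE; apply/imsetP/idP.
        case=> b1; rewrite inE => ub ->; apply: connect_homo ub.
        by move=> a c /h1; apply: connect1.
      by case/step=> b1 -> ub; exists b1; rewrite ?inE.
    have inH b : connect e (i u1) b -> b \notin codom j.
      by case/step=> b1 -> /uH; rewrite H1E.
    rewrite KE; split; apply/innerP; exists (i u1) => // b /inH.
      exact: HI.
    by rewrite inE.
  by rewrite card_imset //; apply: imset_inj.
rewrite -(card_in_imset (f := fun K : {set V} => j @^-1: K)).
  congr #|pred_of_set _|; apply/setP=> K'; apply/imsetP/innerP.
    case=> K /setDP[/innerP[u defK uI] nKH] ->.
    have [w uw] : exists w, connect e u (j w).
      case: (pickP [pred w | connect e u (j w)]) => [w|no]; first by exists w.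
      case/innerP: nKH; exists u => // v uv; rewrite inE.
      by apply/negP=> /codomP[w vE]; have := no w; rewrite /= -vE uv.
    exists w; first by apply/setP=> v; rewrite defK !inE contract_connect (same_connect es uw).
    by move=> v; rewrite contract_connect -I'E -(same_connect es uw); apply: uI.
  case=> u defK uI; exists [set v | connect e (j u) v]; last first.
    by rewrite defK; apply/setP=> v; rewrite !inE contract_connect.
  apply/setDP; split; last first.
    apply/innerP=> -[v /setP vE vH].
    have /esym := vE (j u); rewrite !inE connect0 => /vH.
    by rewrite inE codom_f.
  apply/innerP; exists (j u) => // v uv.
  case: (boolP (v \in codom j)) => [/codomP[v' vE]|/HI//].
  by rewrite vE I'E; apply: uI; rewrite contract_connect -vE.
move=> K L /setDP[/innerP[u -> uI] nK] /setDP[/innerP[v -> vI] nL] /setP eqKL.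
have [w uw] : exists w, connect e u (j w).
  case: (pickP [pred w | connect e u (j w)]) => [w|no]; first by exists w.
  case/innerP: nK; exists u => // c uc; rewrite inE.
  by apply/negP=> /codomP[w vE]; have := no w; rewrite /= -vE uc.
have := eqKL w; rewrite !inE uw => /esym vw.
by apply/setP=> c; rewrite !inE (same_connect es uw) (same_connect es vw).
Qed.

End Contract.

Section Multigraph.
Variable V : finType.
Implicit Types (g : seq {set V}) (u v w : V).

(* A multigraph on V is the list of its edges, each a set of two vertices; a
   repeated entry is a multiple edge. *)
Definition adj g : rel V := fun u v => [set u; v] \in g.

Definition components g : {set {set V}} :=
  equivalence_partition (connect (adj g)) [set: V].

Definition degree g v : nat := count (fun B : {set V} => v \in B) g.

(* A connected finite multigraph is a cycle when it is 2-regular; a double edge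
   is thus a cycle of length 2. *)
Definition loops g : {set {set V}} :=
  [set K in components g | [forall v in K, degree g v == 2]].

Lemma adj_sym g : symmetric (adj g).
Proof. by move=> u v; rewrite /adj setUC. Qed.

Lemma adj_connect_sym g : connect_sym (adj g).
Proof. exact/sym_connect_sym/adj_sym. Qed.

Lemma componentsP g (K : {set V}) :
  reflect (exists u, K = [set v | connect (adj g) u v]) (K \in components g).
Proof.
apply: (iffP imsetP) => [[u _ ->]|[u ->]]; exists u => //.
  by apply/setP=> v; rewrite !inE.
by apply/setP=> v; rewrite !inE.
Qed.

End Multigraph.

Section Diagrams.
Variable n : nat.
Local Notation V2 := ('I_n + 'I_n)%type.

(* The vertex i of \underline n is [inl i] and the vertex i' is [inr i]. *)
Definition is_diagram (P : {set {set V2}}) : bool :=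
  partition P [set: V2] && [forall B in P, #|B| == 2].

Record diagram : predArgType :=
  Diagram { diagram_parts :> {set {set V2}}; _ : is_diagram diagram_parts }.

HB.instance Definition _ := [isSub for diagram_parts].
HB.instance Definition _ := [Finite of diagram by <:].

Implicit Types (x y z : diagram) (u v w : V2).

Lemma diagram_partition x : partition x [set: V2].
Proof. by case: x => P /= /andP[]. Qed.

Lemma diagram_card2 x (B : {set V2}) : B \in diagram_parts x -> #|B| = 2.
Proof. by case: x => P /= /andP[_ /forall_inP h] /h/eqP. Qed.

Lemma is_diagramP (P : {set {set V2}}) :
  (forall B, B \in P -> #|B| = 2) ->
  (forall u, exists2 B, B \in P & u \in B) ->
  (forall u B B', B \in P -> B' \in P -> u \in B -> u \in B' -> B = B') ->
  is_diagram P.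
Proof.
move=> P2 Pex Puniq; apply/andP; split; last by apply/forall_inP=> B /P2->.
apply/and3P; split.
- rewrite eqEsubset subsetT /=; apply/subsetP=> u _.
  by have [B PB uB] := Pex u; apply/bigcupP; exists B.
- apply/trivIsetP=> B B' PB PB' neB; rewrite -setI_eq0; apply/eqP/setP=> u.
  rewrite !inE; apply/negP=> /andP[uB uB'].
  by rewrite (Puniq u B B') ?eqxx in neB.
by apply/negP=> /P2; rewrite cards0.
Qed.

Lemma diagram_part_uniq x u (B B' : {set V2}) :
  B \in diagram_parts x -> B' \in diagram_parts x -> u \in B -> u \in B' -> B = B'.
Proof.
move=> xB xB' uB uB'; have /and3P[_ tI _] := diagram_partition x.
by rewrite -(def_pblock tI xB uB) (def_pblock tI xB' uB').
Qed.

Definition mate x u : V2 := odflt u [pick v | [set u; v] \in diagram_parts x].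

Lemma mateE x u v : ([set u; v] \in diagram_parts x) = (v == mate x u).
Proof.
have neq a b : [set a; b] \in diagram_parts x -> b != a.
  by move/diagram_card2/eqP; rewrite cards2 eqSS eqb1 eq_sym.
have [B xB uB] : exists2 B, B \in diagram_parts x & u \in B.
  have /and3P[/eqP cov _ _] := diagram_partition x.
  by have := in_setT u; rewrite -cov => /bigcupP[B]; exists B.
have [w defB] : exists w, B = [set u; w].
  have /eqP/cards2P[a [b [nab defB]]] := diagram_card2 xB.
  move: uB; rewrite defB !inE => /orP[]/eqP->; first by exists b.
  by exists a; rewrite setUC.
rewrite /mate; case: pickP => [a xa /=|/(_ w)]; last by rewrite -defB xB.
apply/idP/eqP => [xv|->//].
have: v \in [set u; a].
  by rewrite (diagram_part_uniq (u := u) xa xv) !inE eqxx ?orbT.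
by rewrite !inE (negPf (neq _ _ xv)) => /eqP.
Qed.

Lemma mate_neq x u : mate x u != u.
Proof.
have: [set u; mate x u] \in diagram_parts x by rewrite mateE.
by move/diagram_card2/eqP; rewrite cards2 eqSS eqb1 eq_sym.
Qed.

Lemma mateK x : involutive (mate x).
Proof. by move=> u; apply/esym/eqP; rewrite -mateE setUC mateE. Qed.

Lemma partE x (B : {set V2}) : B \in diagram_parts x ->
  exists u, B = [set u; mate x u].
Proof.
move=> xB; have /eqP/cards2P[a [b [nab defB]]] := diagram_card2 xB.
by exists a; move: xB; rewrite defB mateE => /eqP->.
Qed.

Lemma diagram_sub_eq x y :
  (forall u, [set u; mate x u] \in diagram_parts y) -> x = y.
Proof.
move=> h; have mE u : mate x u = mate y u by apply/eqP; rewrite -mateE.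
apply/val_inj/setP => /= B; apply/idP/idP => /partE[u ->].
  by rewrite mE mateE.
by rewrite -mE mateE.
Qed.

Lemma id_diagram_subproof :
  is_diagram [set [set inl i; inr i] | i : 'I_n].
Proof.
apply: is_diagramP => [B /imsetP[i _ ->]|u|u B B'].
- by rewrite cards2.
- by case: u => i; exists [set inl i; inr i]; rewrite ?inE ?eqxx ?orbT //;
    apply/imsetP; exists i.
move=> /imsetP[i _ ->] /imsetP[j _ ->]; rewrite !inE.
by case: u => k /orP[]/eqP[]// -> /orP[]/eqP[]// ->.
Qed.

Definition id_diagram := Diagram id_diagram_subproof.

(* The concatenation of x and y lives on three columns: [inl (inl i)] is the
   vertex i of x, [inl (inr i)] is i' of x identified with i of y, and [inr i]
   is i' of y. *)
Local Notation V3 := ('I_n + 'I_n + 'I_n)%type.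

Definition glue_right (u : V2) : V3 :=
  match u with inl i => inl (inr i) | inr i => inr i end.

Definition glue_outer (u : V2) : V3 :=
  match u with inl i => inl (inl i) | inr i => inr i end.

Definition glue x y : seq {set V3} :=
  [seq [set inl u | u in B] | B : {set V2} in diagram_parts x] ++
  [seq [set glue_right u | u in B] | B : {set V2} in diagram_parts y].

Definition compose_parts x y : {set {set V2}} :=
  equivalence_partition
    (fun u v => connect (adj (glue x y)) (glue_outer u) (glue_outer v))
    [set: V2].

Lemma glue_right_inj : injective glue_right.
Proof. by case=> i [] j //= [->]. Qed.

Lemma glue_outer_inj : injective glue_outer.
Proof. by case=> i [] j //= [->]. Qed.


Lemma edgeP (W : finType) (k : V2 -> W) x (a b : W) : injective k ->
  reflect (exists u, a = k u /\ b = k (mate x u))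
    ([set a; b] \in [seq [set k u | u in B] | B : {set V2} in diagram_parts x]).
Proof.
move=> kI; apply: (iffP imageP) => [[B /partE[u ->]]|[u [-> ->]]]; last first.
  by exists [set u; mate x u]; rewrite ?mateE // imsetU1 imset_set1.
rewrite imsetU1 imset_set1 => eqab.
have neq : k (mate x u) != k u by rewrite (inj_eq kI) mate_neq.
have := set21 a b; have := set22 a b; rewrite eqab !inE.
case/orP=> /eqP bE /orP[]/eqP aE.
- have := set22 (k u) (k (mate x u)).
  by rewrite -eqab !inE aE bE orbb (negPf neq).
- by exists (mate x u); rewrite mateK.
- by exists u.
- have := set21 (k u) (k (mate x u)).
  by rewrite -eqab !inE aE bE orbb eq_sym (negPf neq).
Qed.

Lemma edge_degree (W : finType) (k : V2 -> W) x (a : W) : injective k ->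
  count (fun B : {set W} => a \in B)
    [seq [set k u | u in B] | B : {set V2} in diagram_parts x] = (a \in codom k).
Proof.
move=> kI; rewrite /image_mem count_map.
case: (boolP (a \in codom k)) => [/codomP[u ->]|na]; last first.
  apply/eqP; rewrite -leqn0 leqNgt -has_count; apply/hasPn=> B _ /=.
  by apply: contra na => /imsetP[u _ ->]; apply: codom_f.
have uniqE := count_uniq_mem [set u; mate x u] (enum_uniq (diagram_parts x)).
rewrite mem_enum mateE eqxx in uniqE; rewrite -[RHS]uniqE.
apply: eq_in_count => B; rewrite mem_enum /= mem_imset // => xB.
apply/idP/eqP => [uB|->]; last by rewrite set21.
by apply: diagram_part_uniq xB _ uB (set21 _ _); rewrite mateE.
Qed.

Lemma glue_adjP x y (a b : V3) :
  reflect ((exists u, a = inl u /\ b = inl (mate x u)) \/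
           (exists u, a = glue_right u /\ b = glue_right (mate y u)))
    (adj (glue x y) a b).
Proof.
rewrite /adj /glue mem_cat.
apply: (iffP orP) => -[h|h]; [left|right|left|right]; apply/edgeP=> //.
all: try exact: inl_inj.
all: exact: glue_right_inj.
Qed.

Definition glue_f x (a : V3) : V3 :=
  match a with inl u => inl (mate x u) | inr i => inr i end.

Definition glue_g y (a : V3) : V3 :=
  match a with
  | inl (inl i) => inl (inl i)
  | inl (inr i) => glue_right (mate y (inl i))
  | inr i => glue_right (mate y (inr i))
  end.

Lemma glue_gE y u : glue_g y (glue_right u) = glue_right (mate y u).
Proof. by case: u. Qed.

Lemma glue_fK x : involutive (glue_f x).
Proof. by case=> [u|i] //=; rewrite mateK. Qed.

Lemma glue_gK y : involutive (glue_g y).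
Proof. by case=> [[i|i]|i] //=; rewrite glue_gE mateK. Qed.

Lemma glue_f_fix x a : (glue_f x a == a) = (a \in codom (@inr V2 'I_n)).
Proof.
case: a => [u|i] /=; last by rewrite eqxx codom_f.
rewrite (inj_eq inl_inj) (negPf (mate_neq x u)).
by apply/esym/negP=> /codomP[].
Qed.

Lemma glue_g_fix y a :
  (glue_g y a == a) = (a \in codom (fun i : 'I_n => inl (inl i) : V3)).
Proof.
case: a => [[i|i]|i] /=; first by rewrite eqxx (codom_f (fun i : 'I_n => inl (inl i) : V3)).
  rewrite -[X in _ == X]/(glue_right (inl i)) (inj_eq glue_right_inj).
  by rewrite (negPf (mate_neq _ _)); apply/esym/negP=> /codomP[].
rewrite -[X in _ == X]/(glue_right (inr i)) (inj_eq glue_right_inj).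
by rewrite (negPf (mate_neq _ _)); apply/esym/negP=> /codomP[].
Qed.

Lemma glue_fix x y a :
  (glue_f x a == a) || (glue_g y a == a) = (a \in codom glue_outer).
Proof.
rewrite glue_f_fix glue_g_fix; apply/orP/codomP.
  by case=> /codomP[i ->]; [exists (inr i)|exists (inl i)].
by case=> -[i|i] ->; [right|left]; apply/codomP; exists i.
Qed.

Lemma glue_nofix x y a : ~~ ((glue_f x a == a) && (glue_g y a == a)).
Proof.
by rewrite glue_f_fix glue_g_fix; apply/negP=> /andP[/codomP[i ->] /codomP[]].
Qed.

Lemma glue_connect x y :
  connect (adj (glue x y)) =2
  connect (fun a b => (b == glue_f x a) || (b == glue_g y a)).
Proof.
move=> a b; apply/idP/idP; apply: connect_sub => {a b} a b.
  case/glue_adjP=> -[u [-> ->]]; apply: connect1; first by rewrite /= eqxx.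
  by rewrite glue_gE eqxx orbT.
case/orP=> /eqP->; case: a => [[i|i]|i] /=;
  try exact: connect0; apply: connect1; apply/glue_adjP.
- by left; exists (inl i).
- by left; exists (inr i).
- by right; exists (inl i).
- by right; exists (inr i).
Qed.

Lemma compose_class x y u : exists2 w, w != u &
  forall v, connect (adj (glue x y)) (glue_outer u) (glue_outer v) =
            (v \in [:: u; w]).
Proof.
have ends : exists2 w, w != glue_outer u & forall a,
    (connect (adj (glue x y)) (glue_outer u) a && (a \in codom glue_outer)) =
    (a \in [:: glue_outer u; w]).
  case: u => i.
    have [w wu wP] := dihedral_ends (glue_fK x) (glue_gK y) (glue_nofix x y)
                       (erefl : glue_g y (glue_outer (inl i)) = glue_outer (inl i)).
    by exists w => // a; rewrite -wP glue_fix glue_connect.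
  have nofix a : ~~ ((glue_g y a == a) && (glue_f x a == a)).
    by rewrite andbC glue_nofix.
  have [w wu wP] := dihedral_ends (glue_gK y) (glue_fK x) nofix
                     (erefl : glue_f x (glue_outer (inr i)) = glue_outer (inr i)).
  exists w => // a; rewrite -wP orbC glue_fix glue_connect; congr (_ && _).
  by apply: eq_connect => b c; rewrite orbC.
case: ends => w0 wu wP.
have /andP[_ /codomP[w wE]] : connect (adj (glue x y)) (glue_outer u) w0
    && (w0 \in codom glue_outer) by rewrite wP !inE eqxx orbT.
exists w; first by apply: contra wu => /eqP<-; rewrite wE.
move=> v; have := wP (glue_outer v).
by rewrite codom_f andbT !inE wE !(inj_eq glue_outer_inj).
Qed.

Lemma compose_subproof x y : is_diagram (compose_parts x y).
Proof.
apply/andP; split.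
  apply/equivalence_partitionP=> u v w _ _ _; split; first exact: connect0.
  by move=> uv; apply: (same_connect (@adj_connect_sym _ _) uv).
apply/forall_inP=> B /imsetP[u _ ->].
have [w wu uP] := compose_class x y u.
set K := (X in #|pred_of_set X|); have -> : K = [set u; w].
  by apply/setP=> v; rewrite !inE uP !inE.
by rewrite cards2 (eq_sym u) wu.
Qed.

Definition compose x y : diagram := Diagram (compose_subproof x y).

Definition nloops x y : nat := #|loops (glue x y)|.

Lemma compose_connect x y u v :
  connect (adj (glue x y)) (glue_outer u) (glue_outer v) =
  (v \in [:: u; mate (compose x y) u]).
Proof.
have [w wu uP] := compose_class x y u; rewrite uP.
suff -> : mate (compose x y) u = w by [].
apply/esym/eqP; rewrite -mateE; apply/imsetP; exists u => //.
by apply/setP=> c; rewrite !inE uP !inE.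
Qed.

Lemma nloopsE x y :
  nloops x y = #|inner (adj (glue x y)) [set a | a \notin codom glue_outer]|.
Proof.
rewrite /nloops; congr #|pred_of_set _|; apply/setP=> K; rewrite !inE; congr (_ && _).
apply/forall_inP/subsetP => h a /h; rewrite /degree /glue count_cat !edge_degree ?inE;
  do ?[exact: inl_inj | exact: glue_right_inj].
  case: a => [[i|i]|i].
  - have /negPf-> : inl (inl i) \notin codom glue_right.
      by apply/negP=> /codomP[[]].
    by case: (_ \in _).
  - by move=> _; apply/negP=> /codomP[[]].
  have /negPf-> : inr i \notin codom (@inl V2 'I_n) by apply/negP=> /codomP[].
  by case: (_ \in _).
case: a => [[i|i]|i] //.
- by rewrite (codom_f glue_outer (inl i)).
- by rewrite codom_f (codom_f glue_right (inl i)).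
by rewrite (codom_f glue_outer (inr i)).
Qed.

(* Associativity is proved on the concatenation of three diagrams, which lives
   on the four columns [inl (inl (inl _))], [inl (inl (inr _))], [inl (inr _)]
   and [inr _]. *)
Local Notation V4 := ('I_n + 'I_n + 'I_n + 'I_n)%type.

Let c01 (u : V2) : V4 := inl (inl u).
Let c12 (u : V2) : V4 := inl (glue_right u).
Let c23 (u : V2) : V4 :=
  match u with inl i => inl (inr i) | inr i => inr i end.
Let c012 (a : V3) : V4 := inl a.
Let c023 (a : V3) : V4 :=
  match a with
  | inl (inl i) => inl (inl (inl i))
  | inl (inr i) => inl (inr i)
  | inr i => inr i
  end.
Let c123 (a : V3) : V4 :=
  match a with inl u => inl (glue_right u) | inr i => inr i end.
Let c013 (a : V3) : V4 :=
  match a with inl u => inl (inl u) | inr i => inr i end.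

Let glue3 x y z : seq {set V4} :=
  [seq [set c01 u | u in B] | B : {set V2} in diagram_parts x] ++
  [seq [set c12 u | u in B] | B : {set V2} in diagram_parts y] ++
  [seq [set c23 u | u in B] | B : {set V2} in diagram_parts z].

Let c01I : injective c01. Proof. by move=> u v []. Qed.
Let c12I : injective c12. Proof. by move=> u v [/glue_right_inj]. Qed.
Let c23I : injective c23. Proof. by case=> i [] j //= [->]. Qed.
Let c012I : injective c012. Proof. by move=> u v []. Qed.
Let c023I : injective c023. Proof. by case=> [[]|] i [[]|] j //= [->]. Qed.
Let c123I : injective c123. Proof. by case=> [[]|] i [[]|] j //= [->]. Qed.
Let c013I : injective c013. Proof. by case=> [[]|] i [[]|] j //= [->]. Qed.

Let glue3P x y z (a b : V4) :
  reflect [\/ exists u, a = c01 u /\ b = c01 (mate x u),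
              exists u, a = c12 u /\ b = c12 (mate y u) |
              exists u, a = c23 u /\ b = c23 (mate z u)]
    (adj (glue3 x y z) a b).
Proof.
rewrite /adj /glue3 !mem_cat.
apply: (iffP or3P) => -[h|h|h]; [apply: Or31|apply: Or32|apply: Or33| 
  apply: Or31|apply: Or32|apply: Or33]; exact/edgeP.
Qed.

Let compose_step x y u v :
  connect (adj (glue x y)) (glue_outer u) (glue_outer v) =
  (v == u) || (v == mate (compose x y) u).
Proof. by rewrite compose_connect !inE. Qed.

Let glue3_left x y z :
  (forall a b, connect (adj (glue (compose x y) z)) a b =
               connect (adj (glue3 x y z)) (c023 a) (c023 b)) /\
  nloops x y + nloops (compose x y) z =
    #|inner (adj (glue3 x y z)) [set a | a \notin codom (c023 \o glue_outer)]|.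
Proof.
have s1 := @adj_connect_sym _ (glue x y).
have s' := @adj_connect_sym _ (glue (compose x y) z).
have s := @adj_connect_sym _ (glue3 x y z).
have h1 a b : adj (glue x y) a b -> adj (glue3 x y z) (c012 a) (c012 b).
  case/glue_adjP=> -[u [-> ->]]; apply/glue3P; [apply: Or31|apply: Or32];
  by exists u.
have h2 a b : adj (glue3 x y z) a b ->
    (exists a1 b1, [/\ a = c012 a1, b = c012 b1 & adj (glue x y) a1 b1]) \/
    (exists a' b', [/\ a = c023 a', b = c023 b' &
                       connect (adj (glue (compose x y) z)) a' b']).
  case/glue3P=> -[u [-> ->]].
  - left; exists (inl u), (inl (mate x u)); split=> //.
    by apply/glue_adjP; left; exists u.
  - left; exists (glue_right u), (glue_right (mate y u)); split=> //.
    by apply/glue_adjP; right; exists u.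
  right; exists (glue_right u), (glue_right (mate z u)).
  split; [by case: u | by case: (mate z u) | apply/connect1/glue_adjP].
  by right; exists u.
have c02 a1 a' : c012 a1 = c023 a' -> exists2 u, a1 = glue_outer u & a' = inl u.
  case: a' => [[i|i]|i] //= [->]; by [exists (inl i) | exists (inr i)].
have h3 a1 b1 a' b' : c012 a1 = c023 a' -> c012 b1 = c023 b' ->
    connect (adj (glue x y)) a1 b1 ->
    connect (adj (glue (compose x y) z)) a' b'.
  move=> /c02[u -> ->] /c02[v -> ->]; rewrite compose_step.
  case/orP=> /eqP->; first exact: connect0.
  by apply/connect1/glue_adjP; left; exists u.
have h4 a b : adj (glue (compose x y) z) a b ->
    connect (adj (glue3 x y z)) (c023 a) (c023 b).
  case/glue_adjP=> -[u [-> ->]].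
    have E v : c023 (inl v) = c012 (glue_outer v) by case: v.
    rewrite !E; apply: (connect_homo (fun c d cd => connect1 (h1 c d cd))).
    by rewrite compose_step eqxx orbT.
  apply/connect1/glue3P; apply: Or33; exists u.
  by split; [case: u | case: (mate z u)].
have h5 a : a \notin codom c023 -> a \in codom c012.
  case: a => [a _|i]; first exact: (codom_f c012).
  by rewrite (codom_f c023 (inr i)).
split; first exact: (contract_connect c012I c023I h2 h3 h4).
rewrite !nloopsE.
apply/esym/(contract_inner c012I c023I s h1 h2 h3 h4 h5) => a.
- rewrite inE; congr (~~ _); apply/codomP/codomP => -[].
    by case=> i ->; [exists (inl (inl i))|exists (inl (inr i))].
  by case=> [[i|i]|i] //= [->]; [exists (inl i)|exists (inr i)].
- by rewrite inE; apply: contra => /codomP[u ->]; apply: codom_f.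
rewrite !inE; congr (~~ _); apply/codomP/codomP => -[u].
  by move/c023I->; exists u.
by move->; exists u.
Qed.

Let glue3_right x y z :
  (forall a b, connect (adj (glue x (compose y z))) a b =
               connect (adj (glue3 x y z)) (c013 a) (c013 b)) /\
  nloops y z + nloops x (compose y z) =
    #|inner (adj (glue3 x y z)) [set a | a \notin codom (c013 \o glue_outer)]|.
Proof.
have s1 := @adj_connect_sym _ (glue y z).
have s' := @adj_connect_sym _ (glue x (compose y z)).
have s := @adj_connect_sym _ (glue3 x y z).
have h1 a b : adj (glue y z) a b -> adj (glue3 x y z) (c123 a) (c123 b).
  case/glue_adjP=> -[u [-> ->]]; apply/glue3P; [apply: Or32|apply: Or33];
  by exists u; split; [case: (u) | case: (mate _ u)].
have h2 a b : adj (glue3 x y z) a b ->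
    (exists a1 b1, [/\ a = c123 a1, b = c123 b1 & adj (glue y z) a1 b1]) \/
    (exists a' b', [/\ a = c013 a', b = c013 b' &
                       connect (adj (glue x (compose y z))) a' b']).
  case/glue3P=> -[u [-> ->]].
  - right; exists (inl u), (inl (mate x u)); split=> //.
    by apply/connect1/glue_adjP; left; exists u.
  - left; exists (inl u), (inl (mate y u)); split=> //.
    by apply/glue_adjP; left; exists u.
  left; exists (glue_right u), (glue_right (mate z u)).
  split; [by case: u | by case: (mate z u) | apply/glue_adjP].
  by right; exists u.
have c02 a1 a' : c123 a1 = c013 a' ->
    exists2 u, a1 = glue_outer u & a' = glue_right u.
  by case: a1 a' => [[i|i]|i] [[j|j]|j] //= [->]; [exists (inl j)|exists (inr j)].
have h3 a1 b1 a' b' : c123 a1 = c013 a' -> c123 b1 = c013 b' ->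
    connect (adj (glue y z)) a1 b1 ->
    connect (adj (glue x (compose y z))) a' b'.
  move=> /c02[u -> ->] /c02[v -> ->]; rewrite compose_step.
  case/orP=> /eqP->; first exact: connect0.
  by apply/connect1/glue_adjP; right; exists u.
have h4 a b : adj (glue x (compose y z)) a b ->
    connect (adj (glue3 x y z)) (c013 a) (c013 b).
  case/glue_adjP=> -[u [-> ->]].
    by apply/connect1/glue3P; apply: Or31; exists u.
  have E v : c013 (glue_right v) = c123 (glue_outer v) by case: v.
  rewrite !E; apply: (connect_homo (fun c d cd => connect1 (h1 c d cd))).
  by rewrite compose_step eqxx orbT.
have h5 a : a \notin codom c013 -> a \in codom c123.
  case: a => [[[i|i]|i]|i]; last 1 first.
  - by rewrite (codom_f c013 (inr i)).
  - by rewrite (codom_f c013 (inl (inl i))).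
  - by rewrite (codom_f c013 (inl (inr i))).
  by rewrite (codom_f c123 (inl (inr i))).
split; first exact: (contract_connect c123I c013I h2 h3 h4).
rewrite !nloopsE.
apply/esym/(contract_inner c123I c013I s h1 h2 h3 h4 h5) => a.
- rewrite inE; congr (~~ _); apply/codomP/codomP => -[].
    by case=> i ->; [exists (inl (inr i))|exists (inr i)].
  by case: a => [[i|i]|i] [[j|j]|j] //= [->]; [exists (inl j)|exists (inr j)].
- by rewrite inE; apply: contra => /codomP[u ->]; apply: codom_f.
rewrite !inE; congr (~~ _); apply/codomP/codomP => -[u].
  by move/c013I->; exists u.
by move->; exists u.
Qed.

Let c03E : c023 \o glue_outer =1 c013 \o glue_outer. Proof. by case. Qed.

Lemma composeA : associative compose.
Proof.
move=> x y z; apply: diagram_sub_eq => u.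
rewrite mateE; have := compose_step (compose x y) z u.
move=> /(_ (mate (compose x (compose y z)) u)).
rewrite (negPf (mate_neq _ _)) /= => <-.
have E v : c023 (glue_outer v) = c013 (glue_outer v) by case: v.
have [-> _] := glue3_left x y z; rewrite !E.
have [<- _] := glue3_right x y z.
by rewrite compose_step eqxx orbT.
Qed.

Lemma nloopsA x y z :
  nloops x y + nloops (compose x y) z = nloops y z + nloops x (compose y z).
Proof.
have [_ ->] := glue3_left x y z; have [_ ->] := glue3_right x y z.
by congr #|pred_of_set (inner _ _)|; apply/setP=> a; rewrite !inE (eq_codom c03E).
Qed.

Let mate_id (i : 'I_n) : mate id_diagram (inl i) = inr i.
Proof. by apply/esym/eqP; rewrite -mateE; apply/imsetP; exists i. Qed.

Lemma compose1x : left_id id_diagram compose.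
Proof.
move=> x; apply/esym/diagram_sub_eq => u; rewrite mateE.
have := compose_step id_diagram x u (mate x u).
rewrite (negPf (mate_neq _ _)) /= => <-.
have E v : connect (adj (glue id_diagram x)) (glue_outer v) (glue_right v).
  case: v => i /=; last exact: connect0.
  by apply/connect1/glue_adjP; left; exists (inl i); rewrite mate_id.
apply: connect_trans (E u) _; rewrite adj_connect_sym.
apply: connect_trans (E _) _; apply/connect1/glue_adjP; right.
by exists (mate x u); rewrite mateK.
Qed.

Lemma composex1 : right_id id_diagram compose.
Proof.
move=> x; apply/esym/diagram_sub_eq => u; rewrite mateE.
have := compose_step x id_diagram u (mate x u).
rewrite (negPf (mate_neq _ _)) /= => <-.
have E v : connect (adj (glue x id_diagram)) (glue_outer v) (inl v).
  case: v => i /=; first exact: connect0.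
  rewrite adj_connect_sym.
  by apply/connect1/glue_adjP; right; exists (inl i); rewrite mate_id.
apply: connect_trans (E u) _; rewrite adj_connect_sym.
apply: connect_trans (E _) _; apply/connect1/glue_adjP; left.
by exists (mate x u); rewrite mateK.
Qed.

Lemma nloops1x x : nloops id_diagram x = 0.
Proof.
apply/eqP; rewrite nloopsE cards_eq0; apply/set0Pn=> -[K /innerP[u _ uI]].
have := uI u (connect0 _ _); rewrite inE.
case: u uI => [[i|i]|i] uI; first by rewrite (codom_f glue_outer (inl i)).
  have /uI : connect (adj (glue id_diagram x)) (inl (inr i)) (glue_outer (inl i)).
    rewrite adj_connect_sym.
    by apply/connect1/glue_adjP; left; exists (inl i); rewrite mate_id.
  by rewrite inE codom_f.
by rewrite (codom_f glue_outer (inr i)).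
Qed.

Lemma nloopsx1 x : nloops x id_diagram = 0.
Proof.
apply/eqP; rewrite nloopsE cards_eq0; apply/set0Pn=> -[K /innerP[u _ uI]].
have := uI u (connect0 _ _); rewrite inE.
case: u uI => [[i|i]|i] uI; first by rewrite (codom_f glue_outer (inl i)).
  have /uI : connect (adj (glue x id_diagram)) (inl (inr i)) (glue_outer (inr i)).
    by apply/connect1/glue_adjP; right; exists (inl i); rewrite mate_id.
  by rewrite inE codom_f.
by rewrite (codom_f glue_outer (inr i)).
Qed.

End Diagrams.

Local Open Scope ring_scope.

(* Br_n(delta): the free module on diagrams; delta only enters the product. *)
Definition brauer (R : comNzRingType) (n : nat) (delta : R) : Type :=
  {ffun diagram n -> R^o}.

HB.instance Definition _ (R : comNzRingType) n (delta : R) :=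
  GRing.Lmodule.copy (brauer n delta) {ffun diagram n -> R^o}.

(* Locked because failing unifications would otherwise unfold down to the
   enumeration of all diagrams. *)
HB.lock Definition coeff (R : comNzRingType) (n : nat) (delta : R)
  (f : brauer n delta) (x : diagram n) : R := (f : {ffun diagram n -> R^o}) x.

(* The basis element of a diagram. *)
HB.lock Definition dvec (R : comNzRingType) (n : nat) (delta : R)
  (x : diagram n) : brauer n delta := [ffun z => (z == x)%:R : R].

Section BrauerAlgebra.
Variables (R : comNzRingType) (n : nat) (delta : R).
Local Notation brauer := (brauer n delta).

Implicit Types (x y z : diagram n) (f g h : brauer).

Local Notation dvec := (dvec delta).

Definition dmul x y : brauer := delta ^+ nloops x y *: dvec (compose x y).

Definition brauer_mul f g : brauer :=
  \sum_x \sum_y (coeff f x * coeff g y) *: dmul x y.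

Lemma coeffP f g : coeff f =1 coeff g -> f = g.
Proof. by move=> h; rewrite coeff.unlock in h; apply/ffunP. Qed.

Lemma coeffD f g x : coeff (f + g) x = coeff f x + coeff g x.
Proof. by rewrite coeff.unlock ffunE. Qed.

Lemma coeffZ a f x : coeff (a *: f) x = a * coeff f x.
Proof. by rewrite coeff.unlock ffunE. Qed.

Lemma coeff0 x : coeff (0 : brauer) x = 0.
Proof. by rewrite -(scale0r (0 : brauer)) coeffZ mul0r. Qed.

Lemma coeff_dvec x z : coeff (dvec x) z = (z == x)%:R.
Proof. by rewrite coeff.unlock dvec.unlock ffunE. Qed.

Lemma coeff_sum (I : finType) (F : I -> brauer) x :
  coeff (\sum_i F i) x = \sum_i coeff (F i) x.
Proof.
apply: (big_morph (fun f : brauer => coeff f x)) => [f g|]; [exact: coeffD | exact: coeff0].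
Qed.

Lemma brauer_sum f : f = \sum_x coeff f x *: dvec x.
Proof.
apply: coeffP => z; rewrite coeff_sum (bigD1 z) //= big1 => [|x xz].
  by rewrite coeffZ coeff_dvec eqxx mulr1 addr0.
by rewrite coeffZ coeff_dvec eq_sym (negPf xz) mulr0.
Qed.

Lemma brauer_mulDl : left_distributive brauer_mul +%R.
Proof.
move=> f g h; rewrite -big_split; apply: eq_bigr => x _ /=.
rewrite -big_split; apply: eq_bigr => y _ /=.
by rewrite coeffD mulrDl scalerDl.
Qed.

Lemma brauer_mulDr : right_distributive brauer_mul +%R.
Proof.
move=> f g h; rewrite -big_split; apply: eq_bigr => x _ /=.
rewrite -big_split; apply: eq_bigr => y _ /=.
by rewrite coeffD mulrDr scalerDl.
Qed.

Lemma brauer_scaleAl a f g : a *: brauer_mul f g = brauer_mul (a *: f) g.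
Proof.
rewrite scaler_sumr; apply: eq_bigr => x _; rewrite scaler_sumr.
by apply: eq_bigr => y _; rewrite coeffZ scalerA mulrA.
Qed.

Lemma brauer_scaleAr a f g : a *: brauer_mul f g = brauer_mul f (a *: g).
Proof.
rewrite scaler_sumr; apply: eq_bigr => x _; rewrite scaler_sumr.
by apply: eq_bigr => y _; rewrite coeffZ scalerA mulrCA.
Qed.

Lemma brauer_mul_dvec x y : brauer_mul (dvec x) (dvec y) = dmul x y.
Proof.
rewrite /brauer_mul (bigD1 x) //= (bigD1 y) //=.
rewrite !coeff_dvec !eqxx mulr1 scale1r big1 => [|z zy]; last first.
  by rewrite (coeff_dvec y) (negPf zy) mulr0 scale0r.
rewrite big1 => [|z zx]; first by rewrite !addr0.
by rewrite big1 // => w _; rewrite (coeff_dvec x) (negPf zx) mul0r scale0r.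
Qed.

Lemma brauer_mul0 f : (brauer_mul 0 f = 0) * (brauer_mul f 0 = 0).
Proof.
by split; rewrite -[0 in LHS](scale0r (0 : brauer)) -?brauer_scaleAl
  -?brauer_scaleAr scale0r.
Qed.

Lemma brauer_mul_suml (I : finType) (F : I -> brauer) f :
  brauer_mul (\sum_i F i) f = \sum_i brauer_mul (F i) f.
Proof.
apply: (big_morph (brauer_mul^~ f)) => [g h|]; last by rewrite brauer_mul0.
exact: brauer_mulDl.
Qed.

Lemma brauer_mul_sumr (I : finType) (F : I -> brauer) f :
  brauer_mul f (\sum_i F i) = \sum_i brauer_mul f (F i).
Proof.
apply: (big_morph (brauer_mul f)) => [g h|]; last by rewrite brauer_mul0.
exact: brauer_mulDr.
Qed.

Lemma brauer_mulA : associative brauer_mul.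
Proof.
move=> f g h; rewrite (brauer_sum f).
rewrite !(brauer_mul_suml (fun x => coeff f x *: dvec x)).
rewrite (brauer_mul_suml (fun x => brauer_mul (coeff f x *: dvec x) g)).
apply: eq_bigr => x _; rewrite -!brauer_scaleAl; congr (_ *: _).
rewrite (brauer_sum g) (brauer_mul_suml (fun y => coeff g y *: dvec y)).
rewrite (brauer_mul_sumr (fun y => coeff g y *: dvec y)).
rewrite (brauer_mul_sumr (fun y => brauer_mul (coeff g y *: dvec y) h)).
rewrite (brauer_mul_suml (fun y => brauer_mul (dvec x) (coeff g y *: dvec y))).
apply: eq_bigr => y _.
rewrite -brauer_scaleAl -!brauer_scaleAr -brauer_scaleAl; congr (_ *: _).
rewrite (brauer_sum h) !(brauer_mul_sumr (fun z => coeff h z *: dvec z)).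
rewrite (brauer_mul_sumr (fun z => brauer_mul (dvec y) (coeff h z *: dvec z))).
apply: eq_bigr => z _; rewrite -!brauer_scaleAr; congr (_ *: _).
rewrite !brauer_mul_dvec /dmul -brauer_scaleAl -brauer_scaleAr.
rewrite !brauer_mul_dvec /dmul !scalerA -!exprD composeA; congr (_ ^+ _ *: _).
by rewrite nloopsA.
Qed.

Lemma brauer_mul1 : left_id (dvec (id_diagram n)) brauer_mul.
Proof.
move=> f; rewrite [f in LHS]brauer_sum brauer_mul_sumr [RHS]brauer_sum.
apply: eq_bigr => x _; rewrite -brauer_scaleAr brauer_mul_dvec /dmul.
by rewrite nloops1x compose1x scale1r.
Qed.

Lemma brauer_mulr1 : right_id (dvec (id_diagram n)) brauer_mul.
Proof.
move=> f; rewrite [f in LHS]brauer_sum brauer_mul_suml [RHS]brauer_sum.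
apply: eq_bigr => x _; rewrite -brauer_scaleAl brauer_mul_dvec /dmul.
by rewrite nloopsx1 composex1 scale1r.
Qed.

Lemma brauer_1_neq0 : dvec (id_diagram n) != 0.
Proof.
apply/eqP=> /(congr1 (fun f : brauer => coeff f (id_diagram n))).
by rewrite coeff0 coeff_dvec eqxx => /eqP; rewrite oner_eq0.
Qed.

HB.instance Definition _ := GRing.Zmodule_isNzRing.Build brauer
  brauer_mulA brauer_mul1 brauer_mulr1 brauer_mulDl brauer_mulDr brauer_1_neq0.
HB.instance Definition _ := GRing.Lmodule_isLalgebra.Build R brauer
  brauer_scaleAl.
HB.instance Definition _ := GRing.Lalgebra_isAlgebra.Build R brauer
  brauer_scaleAr.

End BrauerAlgebra.

Section LinkStates.
Variable n : nat.

Definition is_link_state (t : nat) (P : {set {set 'I_n}}) : bool :=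
  [&& partition P [set: 'I_n],
      [forall B in P, (#|B| == 1) || (#|B| == 2)]%N &
      #|[set B in P | #|B| == 1]| == t]%N.

Record link_state (t : nat) : predArgType :=
  LinkState { link_parts :> {set {set 'I_n}}; _ : is_link_state t link_parts }.

HB.instance Definition _ t := [isSub for @link_parts t].
HB.instance Definition _ t := [Finite of link_state t by <:].

Implicit Types (P Q : {set {set 'I_n}}).

Definition arcs P : {set {set 'I_n}} := [set B in P | #|B| == 2]%N.

Definition defects P : {set 'I_n} := [set i | [set i] \in P].

Lemma card_defects t (p : link_state t) : #|defects p| = t.
Proof.
case: p => P /= /and3P[_ _ /eqP <-]; rewrite -[LHS](card_imset _ (@set1_inj _)).
congr #|pred_of_set _|; apply/setP=> B; rewrite inE; apply/imsetP/andP.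
  by case=> i; rewrite inE => Pi ->; rewrite cards1.
by case=> PB /cards1P[i Bi]; exists i; rewrite ?inE -?Bi.
Qed.

(* [enum_val] enumerates a set of ordinals increasingly. *)
Definition defect t (p : link_state t) (i : 'I_t) : 'I_n :=
  enum_val (cast_ord (esym (card_defects p)) i).

Lemma defect_inj t (p : link_state t) : injective (defect p).
Proof. by move=> i j /enum_val_inj/cast_ord_inj. Qed.

Lemma defectP t (p : link_state t) k :
  reflect (exists i, k = defect p i) (k \in defects p).
Proof.
apply: (iffP idP) => [pk|[i ->]]; last exact: enum_valP.
exists (cast_ord (card_defects p) (enum_rank_in pk k)).
by rewrite /defect cast_ordK enum_rankK_in.
Qed.

Lemma link_uniq t (p : link_state t) k (B B' : {set 'I_n}) :
  B \in link_parts p -> B' \in link_parts p -> k \in B -> k \in B' -> B = B'.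
Proof.
case: p => P /= /and3P[/and3P[_ tI _] _ _] PB PB' kB kB'.
by rewrite -(def_pblock tI PB kB) (def_pblock tI PB' kB').
Qed.

Lemma link_cover t (p : link_state t) k :
  (exists2 B, B \in arcs p & k \in B) \/ exists i, k = defect p i.
Proof.
have [B PB kB] : exists2 B, B \in link_parts p & k \in B.
  case: p => P /= /and3P[/and3P[/eqP cov _ _] _ _].
  by have := in_setT k; rewrite -cov => /bigcupP[B]; exists B.
have : (#|B| == 1)%N || (#|B| == 2)%N.
  by case: p PB => P /= /and3P[_ /forall_inP h _] /h.
case/orP=> cB; last by left; exists B; rewrite ?inE ?PB.
right; apply/defectP; rewrite inE.
by case/cards1P: cB PB kB => i -> PB /set1P->.
Qed.

Lemma arc_defect t (p : link_state t) (B : {set 'I_n}) i :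
  B \in arcs p -> defect p i \notin B.
Proof.
rewrite inE => /andP[PB /eqP B2]; apply/negP=> iB.
have : defect p i \in defects p by apply/defectP; exists i.
rewrite inE => Pi; have eqB := link_uniq PB Pi iB (set11 _).
by rewrite eqB cards1 in B2.
Qed.

Definition pair_graph Q P : seq {set 'I_n} := enum (arcs Q) ++ enum (arcs P).

(* Every vertex has degree at most 2 in [pair_graph Q P], so its components
   other than the cycles are paths (possibly reduced to one vertex). *)
Definition pair_set Q P : {set {set 'I_n}} :=
  [set K in components (pair_graph Q P) |
    [&& K \notin loops (pair_graph Q P),
        [exists i in K, i \in defects Q] & [exists i in K, i \in defects P]]].

End LinkStates.

(* The symmetric group on t letters, multiplied as functions: s * u is u followed
   by s, the opposite of the product of 'S_t. *)
Definition Sigma (t : nat) : Type := 'S_t.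

HB.instance Definition _ t := Choice.on (Sigma t).

Section Sigma.
Variable t : nat.

Definition Sigma_mul (s u : Sigma t) : Sigma t := ((u : 'S_t) * (s : 'S_t))%g.
Definition Sigma_inv (s : Sigma t) : Sigma t := ((s : 'S_t)^-1)%g.

Lemma Sigma_mulA : associative Sigma_mul.
Proof. by move=> s u v; rewrite /Sigma_mul mulgA. Qed.
Lemma Sigma_mul1 : left_id (1%g : 'S_t) Sigma_mul.
Proof. by move=> s; rewrite /Sigma_mul mulg1. Qed.
Lemma Sigma_mulr1 : right_id (1%g : 'S_t) Sigma_mul.
Proof. by move=> s; rewrite /Sigma_mul mul1g. Qed.
Lemma Sigma_mulV : left_inverse (1%g : 'S_t) Sigma_inv Sigma_mul.
Proof. by move=> s; rewrite /Sigma_mul /Sigma_inv mulgV. Qed.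
Lemma Sigma_mulrV : right_inverse (1%g : 'S_t) Sigma_inv Sigma_mul.
Proof. by move=> s; rewrite /Sigma_mul /Sigma_inv mulVg. Qed.

HB.instance Definition _ := isGroup.Build (Sigma t)
  Sigma_mulA Sigma_mul1 Sigma_mulr1 Sigma_mulV Sigma_mulrV.

End Sigma.

Section BrauerDatum.
Variable n : nat.

Record brauer_index : predArgType :=
  BrauerIndex { index_ord :> 'I_n.+1; _ : ~~ odd (n - index_ord) }.

HB.instance Definition _ := [isSub for index_ord].
HB.instance Definition _ := [Choice of brauer_index by <:].
HB.instance Definition _ :=
  [SubChoice_isSubPOrder of brauer_index by <: with Order.OrdinalOrder.ord_display].

Definition brauer_group (t : brauer_index) : groupType := Sigma t.

Definition brauer_links (t : brauer_index) : finType := link_state n t.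

Definition link_diagram_parts t (p : link_state n t) (s : Sigma t)
    (q : link_state n t) : {set {set 'I_n + 'I_n}} :=
  [set [set inl i | i in B] | B : {set 'I_n} in arcs p] :|:
  [set [set inr i | i in B] | B : {set 'I_n} in arcs q] :|:
  [set [set inr (defect q i); inl (defect p ((s : 'S_t) i))] | i : 'I_t].

Lemma link_diagram_subproof t (p : link_state n t) (s : Sigma t)
  (q : link_state n t) : is_diagram (link_diagram_parts p s q).
Proof.
have partL B k : B \in link_diagram_parts p s q -> inl k \in B ->
    (exists B0 : {set 'I_n}, [/\ B = inl @: B0, B0 \in arcs p & k \in B0]) \/
    (exists i, k = defect p ((s : 'S_t) i) /\
               B = [set inr (defect q i); inl (defect p ((s : 'S_t) i))]).
  rewrite !inE -orbA => /or3P[] /imsetP[B0 h ->].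
  - by rewrite (mem_imset _ _ inl_inj) => kB; left; exists B0.
  - by case/imsetP.
  by rewrite !inE => /orP[]/eqP // [->]; right; exists B0.
have partR B k : B \in link_diagram_parts p s q -> inr k \in B ->
    (exists B0 : {set 'I_n}, [/\ B = inr @: B0, B0 \in arcs q & k \in B0]) \/
    (exists i, k = defect q i /\
               B = [set inr (defect q i); inl (defect p ((s : 'S_t) i))]).
  rewrite !inE -orbA => /or3P[] /imsetP[B0 h ->].
  - by case/imsetP.
  - by rewrite (mem_imset _ _ inr_inj) => kB; left; exists B0.
  by rewrite !inE => /orP[]/eqP // [->]; right; exists B0.
apply: is_diagramP => [B|u|u B B' PB PB'].
- rewrite !inE -orbA => /or3P[] /imsetP[B0 h ->]; last by rewrite cards2.
    by rewrite card_imset; [move: h; rewrite inE => /andP[_ /eqP] | apply: inl_inj].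
  by rewrite card_imset; [move: h; rewrite inE => /andP[_ /eqP] | apply: inr_inj].
- case: u => k.
    case: (link_cover p k) => [[B pB kB]|[i ->]].
      exists (inl @: B); last by rewrite (mem_imset _ _ inl_inj).
      by rewrite !inE (imset_f (fun B : {set 'I_n} => inl @: B)).
    exists [set inr (defect q ((s : 'S_t)^-1%g i)); inl (defect p i)].
      rewrite !inE; apply/orP; right; apply/imsetP; exists ((s : 'S_t)^-1%g i) => //.
      by rewrite permKV.
    by rewrite !inE eqxx orbT.
  case: (link_cover q k) => [[B pB kB]|[i ->]].
    exists (inr @: B); last by rewrite (mem_imset _ _ inr_inj).
    by rewrite !inE (imset_f (fun B : {set 'I_n} => inr @: B)) ?orbT.
  exists [set inr (defect q i); inl (defect p ((s : 'S_t) i))].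
    by rewrite !inE; apply/orP; right; apply/imsetP; exists i.
  by rewrite !inE eqxx.
case: u => k.
  move=> /(partL _ _ PB)[[B0 [-> pB kB]]|[i [ki ->]]]
         /(partL _ _ PB')[[B1 [-> pB' kB']]|[j [kj ->]]].
  - by move: pB pB'; rewrite !inE => /andP[pB _] /andP[pB' _]; rewrite (link_uniq pB pB' kB kB').
  - by case/negP: (arc_defect ((s : 'S_t) j) pB); rewrite -kj.
  - by case/negP: (arc_defect ((s : 'S_t) i) pB'); rewrite -ki.
  by have /defect_inj/perm_inj -> := etrans (esym ki) kj.
move=> /(partR _ _ PB)[[B0 [-> pB kB]]|[i [ki ->]]]
       /(partR _ _ PB')[[B1 [-> pB' kB']]|[j [kj ->]]].
- by move: pB pB'; rewrite !inE => /andP[pB _] /andP[pB' _]; rewrite (link_uniq pB pB' kB kB').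
- by case/negP: (arc_defect j pB); rewrite -kj.
- by case/negP: (arc_defect i pB'); rewrite -ki.
by have /defect_inj -> := etrans (esym ki) kj.
Qed.

Definition link_diagram t (p : link_state n t) (s : Sigma t)
  (q : link_state n t) : diagram n := Diagram (link_diagram_subproof p s q).

Definition swap (u : 'I_n + 'I_n) : 'I_n + 'I_n :=
  match u with inl i => inr i | inr i => inl i end.

Lemma swapK : involutive swap. Proof. by case. Qed.

Lemma flip_subproof (x : diagram n) :
  is_diagram [set [set swap u | u in B] | B : {set 'I_n + 'I_n} in diagram_parts x].
Proof.
apply: is_diagramP => [B /imsetP[B0 xB ->]|u|u _ _ /imsetP[B xB ->] /imsetP[B' xB' ->]].
- by rewrite card_imset ?(diagram_card2 xB) //; apply: inv_inj swapK.
- exists [set swap v | v in [set swap u; mate x (swap u)]].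
    by apply/imsetP; exists [set swap u; mate x (swap u)]; rewrite ?mateE.
  by apply/imsetP; exists (swap u); rewrite ?set21 ?swapK.
move=> /imsetP[v vB ->] /imsetP[w wB' /(inv_inj swapK) vw].
by rewrite (diagram_part_uniq xB xB' vB) // vw.
Qed.

Definition flip (x : diagram n) : diagram n := Diagram (flip_subproof x).

Variables (R : comNzRingType) (delta : R).

Definition brauer_C (t : brauer_index) (p : brauer_links t)
    (s : brauer_group t) (q : brauer_links t) : brauer n delta :=
  dvec delta (link_diagram p s q).

Definition brauer_star (f : brauer n delta) : brauer n delta :=
  \sum_x coeff f x *: dvec delta (flip x).

End BrauerDatum.

Section DiagramLike.
Variables (R : comNzRingType) (A : algType R).

(* The elements satisfying B are R-linearly independent and span A. *)
Definition is_basis (B : A -> Prop) : Prop :=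
  (forall (s : seq A) (c : A -> R), uniq s -> (forall a, a \in s -> B a) ->
     \sum_(a <- s) c a *: a = 0 -> forall a, a \in s -> c a = 0) /\
  (forall x : A, exists (s : seq A) (c : A -> R),
     (forall a, a \in s -> B a) /\ x = \sum_(a <- s) c a *: a).

Variables (disp : Order.disp_t) (L : porderType disp).
Variables (G : L -> groupType) (M : L -> finType).

(* The functions giving kappa, lambda, p, sigma and q in (DL); the arguments of
   each function are exactly the data on which it may depend. *)
Record product_data := ProductData {
  pd_kappa : forall l1 l2, M l1 -> M l2 -> R;
  pd_label : forall l1 l2, M l1 -> M l2 -> L;
  pd_left : forall l1 l2 (p1 : M l1) (s1 : G l1) (q1 : M l1) (p2 : M l2),
    M (pd_label q1 p2);
  pd_sigma : forall l1 l2 (s1 : G l1) (q1 : M l1) (p2 : M l2) (s2 : G l2),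
    G (pd_label q1 p2);
  pd_right : forall l1 l2 (p1 : M l1) (s1 : G l1) (q1 : M l1)
    (p2 : M l2) (s2 : G l2) (q2 : M l2), M (pd_label q1 p2) }.

Variables (C : forall l, M l -> G l -> M l -> A) (star : A -> A).

Definition C_total (x : {l : L & (M l * G l * M l)%type}) : A :=
  let: existT l (p, s, q) := x in C p s q.

Record diagram_like (D : product_data) : Prop := DiagramLikeWith {
  C_inj : injective C_total;
  C_basis : is_basis (fun a => exists x, a = C_total x);
  star_linear : linear star;
  star_involutive : involutive star;
  star_antimultiplicative : forall a b, star (a * b) = star b * star a;
  star_C : forall l (p q : M l) (s : G l), star (C p s q) = C q s^-1%g p;
  C_mul : forall l1 l2 (p1 q1 : M l1) (s1 : G l1) (p2 q2 : M l2) (s2 : G l2),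
    C p1 s1 q1 * C p2 s2 q2 =
    pd_kappa D q1 p2 *: C (pd_left D p1 s1 q1 p2) (pd_sigma D s1 q1 p2 s2)
                          (pd_right D p1 s1 q1 p2 s2 q2);
  label_le : forall l1 l2 (q1 : M l1) (p2 : M l2),
    (pd_label D q1 p2 <= l1)%O /\ (pd_label D q1 p2 <= l2)%O;
  right_eq : forall l1 l2 (p1 q1 : M l1) (s1 : G l1) (p2 q2 : M l2) (s2 : G l2)
    (e : pd_label D q1 p2 = l2),
    eq_rect _ M (pd_right D p1 s1 q1 p2 s2 q2) l2 e = q2;
  sigma_eq : forall l1 l2 (q1 : M l1) (s1 : G l1) (p2 : M l2) (s2 s2' : G l2)
    (e : pd_label D q1 p2 = l2),
    (eq_rect _ G (pd_sigma D s1 q1 p2 s2) l2 e * s2^-1)%g =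
    (eq_rect _ G (pd_sigma D s1 q1 p2 s2') l2 e * s2'^-1)%g }.

End DiagramLike.

(* Main.v *)
Require Import Defs.
From mathcomp Require Import all_boot all_order all_fingroup all_algebra.

(* A diagram is determined by its left link state, its right link state and the
   permutation by which its through lines join their defects.  In the product of
   the diagrams of (p1, s1, q1) and (p2, s2, q2), a path which leaves the outer
   columns runs through the pair graph of q1 and p2 on the middle column.  So the
   through lines of the product correspond to the defects of q1 which the pair
   graph connects to a defect of p2, the left link state does not depend
   on s2 and q2, and the right one is treated by reflection.  The defects of
   the product are the images, under the increasing enumeration of the defects of
   p1 (resp. q2), of a set of indices which does not depend on p1 (resp. q2); hence
   neither does the permutation.  If the product has t2 through lines, then all
   defects of q2 survive, and the permutation is that of s2 followed by a map
   which only depends on (s1, q1, p2). *)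

Set Implicit Arguments.
Unset Strict Implicit.
Unset Printing Implicit Defensive.

Import Order.TTheory GRing.Theory.

(** * Diagrams as triples of link states and permutations *)

Section Flip.
Variable n : nat.
Implicit Types (x y : diagram n) (u v : 'I_n + 'I_n).

Lemma mate_inj x y : mate x =1 mate y -> x = y.
Proof. by move=> h; apply: diagram_sub_eq => u; rewrite mateE h. Qed.

Lemma mate_flip x u : mate (flip x) u = swap (mate x (swap u)).
Proof.
apply/esym/eqP; rewrite -mateE; apply/imsetP.
exists [set swap u; mate x (swap u)]; first by rewrite mateE.
by rewrite imsetU1 imset_set1 swapK.
Qed.

Lemma flipK : involutive (@flip n).
Proof. by move=> x; apply: mate_inj => u; rewrite !mate_flip !swapK. Qed.

(** Read from the other side, the through edge of index [i] for [q] has index [s i] for [p], which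
    inverts the permutation. *)
Lemma flip_link t (p : link_state n t) (s : Sigma t) (q : link_state n t) :
  flip (link_diagram p s q) = link_diagram q ((s : 'S_t)^-1)%g p.
Proof.
apply: diagram_sub_eq => u.
have: [set u; mate (flip (link_diagram p s q)) u] \in
  diagram_parts (flip (link_diagram p s q)) by rewrite mateE.
case/imsetP=> B PB ->; rewrite !inE -orbA; rewrite !inE -orbA in PB.
case/or3P: PB => /imsetP[C hC ->]; apply/or3P.
- apply: Or32; apply/imsetP; exists C => //.
  by rewrite -imset_comp.
- apply: Or31; apply/imsetP; exists C => //.
  by rewrite -imset_comp.
apply: Or33; apply/imsetP; exists ((s : 'S_t) C) => //.
by rewrite imsetU1 imset_set1 permK /= setUC.
Qed.

End Flip.

Section LinkMate.
Variables (n t : nat) (p q : link_state n t) (s : Sigma t).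

Lemma mate_link_inr a b :
  (mate (link_diagram p s q) (inr a) == inr b) = ([set a; b] \in arcs q).
Proof.
rewrite eq_sym -mateE !inE -orbA; apply/or3P/andP => [|[qB cB]].
  case=> /imsetP[B qB eB].
  - by have := set21 (inr a : 'I_n + 'I_n) (inr b); rewrite eB => /imsetP[].
  - have <- : B = [set a; b].
      by apply: (imset_inj (@inr_inj 'I_n 'I_n)); rewrite -eB imsetU1 imset_set1.
    by move: qB; rewrite inE => /andP.
  have := set22 (inr (defect q B)) (inl (defect p ((s : 'S_t) B))).
  by rewrite -eB !inE.
apply: Or32; apply/imsetP; exists [set a; b]; first by rewrite inE qB.
by rewrite imsetU1 imset_set1.
Qed.

Lemma mate_link_defect_inr i :
  mate (link_diagram p s q) (inr (defect q i)) = inl (defect p ((s : 'S_t) i)).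
Proof.
apply/esym/eqP; rewrite -mateE !inE -orbA; apply/or3P/Or33.
by apply/imsetP; exists i.
Qed.

End LinkMate.

Section LinkMateL.
Variables (n t : nat) (p q : link_state n t) (s : Sigma t).

Lemma mate_link_inl a b :
  (mate (link_diagram p s q) (inl a) == inl b) = ([set a; b] \in arcs p).
Proof.
rewrite -(mate_link_inr q p ((s : 'S_t)^-1)%g) -flip_link mate_flip.
by rewrite -[inr b]/(swap (inl b)) (inj_eq (inv_inj (@swapK n))).
Qed.

Lemma mate_link_defect_inl i :
  mate (link_diagram p s q) (inl (defect p ((s : 'S_t) i))) = inr (defect q i).
Proof. by rewrite -(mate_link_defect_inr p q s) mateK. Qed.

Lemma mate_link_defect_inlV i :
  mate (link_diagram p s q) (inl (defect p i)) =
  inr (defect q ((s : 'S_t)^-1%g i)).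
Proof. by rewrite -{1}(permKV s i) mate_link_defect_inl. Qed.

Lemma link_arc k :
  (exists2 k', [set k; k'] \in arcs p & k \notin defects p) \/ k \in defects p.
Proof.
case: (link_cover p k) => [[B pB kB]|/defectP]; [left|by right].
have /cards2P[a [b [nab defB]]] : (#|B| == 2) by move: pB; rewrite inE => /andP[].
have [w defw] : exists w, B = [set k; w].
  by move: kB; rewrite defB !inE => /orP[]/eqP->; [exists b|exists a; rewrite setUC].
exists w; first by rewrite -defw.
by apply/negP=> /defectP[i ki]; have := arc_defect i pB; rewrite -ki kB.
Qed.

End LinkMateL.

(** * Recovering the link states and the permutation of a diagram *)

Section LeftState.
Variable n : nat.
Implicit Types (x y : diagram n).

Definition through_vertices x : {set 'I_n} := [set k | ~~ is_inl (mate x (inl k))].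

(** Cutting the through edges leaves a link state on the left column; the right link state arises in
    the same way from [flip x]. *)
Definition left_part x (k : 'I_n) : {set 'I_n} :=
  if mate x (inl k) is inl k' then [set k; k'] else [set k].

Definition left_parts x : {set {set 'I_n}} := [set left_part x k | k : 'I_n].

Lemma left_part_id x k : k \in left_part x k.
Proof. by rewrite /left_part; case: mate => ?; rewrite !inE eqxx. Qed.

Lemma left_part_eq x k k' : k' \in left_part x k -> left_part x k' = left_part x k.
Proof.
rewrite /left_part; case E: (mate x (inl k)) => [a|a]; rewrite !inE.
  by case/orP=> /eqP->; rewrite ?E // -E mateK setUC.
by move/eqP->; rewrite E.
Qed.

Lemma card_left_part x k :
  #|left_part x k| = if k \in through_vertices x then 1 else 2.
Proof.
rewrite inE /left_part; case E: (mate x (inl k)) => [a|a] /=; last by rewrite cards1.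
have := mate_neq x (inl k); rewrite E (inj_eq inl_inj) => nk.
by rewrite cards2 eq_sym nk.
Qed.

Lemma through_left_part x k : k \in through_vertices x -> left_part x k = [set k].
Proof. by rewrite inE /left_part; case: mate. Qed.

Lemma left_part_through x k B : B \in left_parts x -> B = [set k] -> k \in through_vertices x.
Proof.
case/imsetP=> k' _ -> E; have := left_part_id x k'; rewrite E inE => /eqP<-.
by have := card_left_part x k'; rewrite E cards1; case: ifP.
Qed.

Lemma left_partsP t x : #|through_vertices x| = t -> is_link_state t (left_parts x).
Proof.
move=> <-; apply/and3P; split.
- apply/and3P; split.
  + rewrite eqEsubset subsetT; apply/subsetP=> k _; apply/bigcupP.
    by exists (left_part x k); rewrite ?left_part_id ?imset_f.
  + apply/trivIsetP=> _ _ /imsetP[a _ ->] /imsetP[b _ ->]; apply: contraR.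
    case/pred0Pn=> k /andP[/= ka kb].
    by rewrite -(left_part_eq ka) (left_part_eq kb).
  by apply/imsetP=> -[k _ E]; have := left_part_id x k; rewrite -E inE.
- by apply/forall_inP=> _ /imsetP[k _ ->]; rewrite card_left_part; case: ifP.
rewrite -(card_imset _ (@set1_inj 'I_n)); apply/eqP; congr #|pred_of_set _|.
apply/setP=> B; rewrite inE; apply/andP/imsetP => [[LB /cards1P[k Bk]]|[k kx ->]].
  by exists k => //; apply: left_part_through LB Bk.
by rewrite cards1 -(through_left_part kx) imset_f.
Qed.

(** The index [t] is kept apart from the cardinality so that the left states of [x] and of [flip x]
    can share one type. *)
Definition left_state t x (h : #|through_vertices x| = t) : link_state n t :=
  LinkState (left_partsP h).

Lemma defects_left_parts x : defects (left_parts x) = through_vertices x.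
Proof.
apply/setP=> k; rewrite inE; apply/idP/idP => [/left_part_through->//|kx].
by rewrite -(through_left_part kx) imset_f.
Qed.

Lemma arcs_left_parts x a b :
  ([set a; b] \in arcs (left_parts x)) = (mate x (inl a) == inl b).
Proof.
rewrite inE; apply/andP/eqP => [[/imsetP[k _ E] cB]|E].
  have ne : b != a by move: cB; rewrite cards2 eqSS eqb1 eq_sym.
  have ka : a \in left_part x k by rewrite -E set21.
  have : b \in left_part x a by rewrite (left_part_eq ka) -E set22.
  rewrite /left_part; case: mate => c; rewrite !inE (negPf ne) //=.
  by move/eqP->.
have := mate_neq x (inl a); rewrite E (inj_eq inl_inj) => ne.
split; last by rewrite cards2 (eq_sym a) ne.
by apply/imsetP; exists a; rewrite // /left_part E.
Qed.

(** A vertex without an arc in its column is a singleton part, so the arcs alone determine all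
    parts. *)
Lemma left_parts_eq x y :
  (forall a b, (mate x (inl a) == inl b) = (mate y (inl a) == inl b)) ->
  left_parts x = left_parts y.
Proof.
move=> h; apply: eq_imset => k; rewrite /left_part.
case E: (mate x (inl k)) => [a|a].
  by have := h k a; rewrite E eqxx => /esym/eqP->.
by case E': (mate y (inl k)) => [b|b] //; have := h k b; rewrite E E' eqxx.
Qed.

Lemma left_parts_link t (p q : link_state n t) (s : Sigma t) :
  left_parts (link_diagram p s q) = link_parts p.
Proof.
have lp k : left_part (link_diagram p s q) k \in link_parts p.
  rewrite /left_part; case: (link_arc p k) => [[k' pk _]|pk].
    have /eqP-> : mate (link_diagram p s q) (inl k) == inl k' by rewrite mate_link_inl.
    by move: pk; rewrite inE => /andP[].
  have/defectP[i ->] := pk; rewrite mate_link_defect_inlV.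
  have: defect p i \in defects p by apply/defectP; exists i.
  by rewrite inE.
apply/setP=> B; apply/imsetP/idP => [[k _ ->]//|pB].
have [k kB] : exists k, k \in B.
  apply/set0Pn; case: (p) pB => P /= /and3P[/and3P[_ _ P0] _ _] PB.
  by apply: contra P0 => /eqP<-.
by exists k => //; apply: link_uniq pB (lp k) kB (left_part_id _ _).
Qed.

Lemma through_link t (p q : link_state n t) (s : Sigma t) :
  through_vertices (link_diagram p s q) = defects p.
Proof. by rewrite -defects_left_parts left_parts_link. Qed.

(** Through edges match the through vertices of the two columns. An injection one way suffices,
    since [flip] is an involution. *)
Lemma card_through_flip x : #|through_vertices (flip x)| = #|through_vertices x|.
Proof.
pose f y k : 'I_n := if mate y (inl k) is inr k' then k' else k.
have fP y k : k \in through_vertices y -> mate y (inl k) = inr (f y k).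
  by rewrite inE /f; case: mate.
have le y : #|through_vertices y| <= #|through_vertices (flip y)|.
  rewrite -(card_in_imset (f := f y)); last first.
    move=> a b /fP ha /fP hb E; apply: inl_inj; apply: (can_inj (mateK y)).
    by rewrite ha hb E.
  apply: subset_leq_card; apply/subsetP=> _ /imsetP[a /fP ha ->].
  by rewrite inE mate_flip /= -ha mateK.
by apply/eqP; rewrite eqn_leq le andbT -{2}(flipK x) le.
Qed.

(** Each defect of the right state is joined to a defect of the left one. Since [mate] is injective,
    so is the resulting map on indices, which is therefore a permutation. *)
Lemma link_decomposition t x (hl : #|through_vertices x| = t)
    (hr : #|through_vertices (flip x)| = t) :
  exists s : Sigma t, x = link_diagram (left_state hl) s (left_state hr).
Proof.
have dl i : defect (left_state hl) i \in through_vertices x.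
  by rewrite -defects_left_parts; apply/(defectP (left_state hl)); exists i.
have dr i : defect (left_state hr) i \in through_vertices (flip x).
  by rewrite -defects_left_parts; apply/(defectP (left_state hr)); exists i.
have ex i : {j | mate x (inr (defect (left_state hr) i)) == inl (defect (left_state hl) j)}.
  apply: sigW; have := dr i; rewrite inE mate_flip /=.
  case E: mate => [k|k] //= _.
  have : k \in defects (left_state hl) by rewrite defects_left_parts inE -E mateK.
  by case/defectP=> j ->; exists j.
pose f i := sval (ex i); have fE i := eqP (svalP (ex i)).
have fI : injective f.
  move=> i j; rewrite /f => E; apply: (@defect_inj _ _ (left_state hr)).
  by apply: inr_inj; apply: (can_inj (mateK x)); rewrite !fE E.
exists (perm fI); apply/esym/mate_inj => -[k|k].
  case: (link_arc (left_state hl) k) => [[k' pk _]|/defectP[i ->]].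
    have := pk; rewrite -(mate_link_inl _ (left_state hr) (perm fI)) => /eqP->.
    by move: pk; rewrite arcs_left_parts => /eqP->.
  rewrite mate_link_defect_inlV; set j := _ i.
  have -> : i = f j by rewrite -(permE fI) permKV.
  by rewrite -fE mateK.
case: (link_arc (left_state hr) k) => [[k' pk _]|/defectP[i ->]].
  have := pk; rewrite -(mate_link_inr (left_state hl) _ (perm fI)) => /eqP->.
  move: pk; rewrite arcs_left_parts mate_flip /= => /eqP.
  by case: mate => //= a [->].
by rewrite mate_link_defect_inr permE fE.
Qed.

(** Counting vertices part by part gives [t] plus an even number. *)
Lemma link_state_parity t (p : link_state n t) : ~~ odd (n - t).
Proof.
case: p => P /= /and3P[part /forall_inP P12 /eqP defT].
have := card_partition part; rewrite cardsT card_ord => E.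
rewrite (bigID (fun B : {set 'I_n} => #|B| == 1)) /= in E.
rewrite (eq_bigr (fun => 1)) in E; last by move=> B /andP[_ /eqP].
rewrite [X in _ + X](eq_bigr (fun => 2)) in E; last first.
  by move=> B /andP[/P12/orP[->//|/eqP]].
rewrite sum1dep_card defT sum_nat_const in E.
by rewrite E addKn oddM andbF.
Qed.

End LeftState.

(** * Paths through the middle column *)

(** Edges from [J] stay in the image of [i], and a vertex of [I] with all neighbours in [I] comes
    from [J]; so the components inside [I] are the images of those inside [J]. This serves both for
    reflection and for restriction to the middle column. *)
Lemma card_inner_embed (U W : finType) (r : rel U) (e : rel W) (i : U -> W)
    (J : {set U}) (I : {set W}) :
  injective i -> (forall a b, e (i a) (i b) = r a b) ->
  (forall a, a \in J -> i a \in I) ->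
  (forall a b, a \in J -> e (i a) b -> b \in codom i) ->
  (forall u, u \in I -> (forall b, e u b -> b \in I) -> u \in i @: J) ->
  #|inner e I| = #|inner r J|.
Proof.
move=> iI er JI Jcl IJ.
have up a b : connect r a b -> connect e (i a) (i b).
  by apply: connect_homo => c d; rewrite -er; apply: connect1.
have down a b : (forall c, connect r a c -> c \in J) -> connect e (i a) b ->
    exists2 c, b = i c & connect r a c.
  move=> aJ /connectP[q]; elim/last_ind: q b => [|q d IH] b /=.
    by move=> _ ->; exists a.
  rewrite rcons_path last_rcons => /andP[/IH-/(_ _ erefl)[c -> ac] cd ->].
  have /codomP[d' dE] := Jcl _ _ (aJ _ ac) cd.
  exists d' => //; apply: connect_trans ac (connect1 _).
  by rewrite -er -dE.
have classE a : (forall c, connect r a c -> c \in J) ->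
    i @: [set v | connect r a v] = [set b | connect e (i a) b].
  move=> aJ; apply/setP=> b; rewrite inE; apply/imsetP/idP => [[c]|/(down _ _ aJ)[c -> ac]].
    by rewrite inE => /up ac ->.
  by exists c; rewrite ?inE.
rewrite -(card_imset _ (imset_inj iI)); congr #|pred_of_set _|.
apply/setP=> K; apply/innerP/imsetP => [[u -> uI]|[L /innerP[a -> aJ] ->]]; last first.
  by rewrite classE //; exists (i a) => // v /(down _ _ aJ)[c -> /aJ/JI].
have inJ v : connect e u v -> v \in i @: J.
  move=> uv; apply: IJ => [|b vb]; first exact: uI.
  by apply: uI; apply: connect_trans uv (connect1 vb).
have /imsetP[a aJ uE] := inJ _ (connect0 _ _); subst u.
have aJ' c : connect r a c -> c \in J.
  by move=> /up/inJ/imsetP[d dJ /iI->].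
exists [set v | connect r a v]; last by rewrite classE.
by apply/innerP; exists a.
Qed.

Section Middle.
Variable n : nat.
Local Notation V3 := ('I_n + 'I_n + 'I_n)%type.
Implicit Types (x y : diagram n) (u v : 'I_n + 'I_n) (a b m : 'I_n).

(* The graph which the right edges of x and the left edges of y form on the
   column where x and y are glued. *)
Definition middle x y : rel 'I_n :=
  fun a b => (mate x (inr a) == inr b) || (mate y (inl a) == inl b).

(* [None] for an outer vertex joined to its own column. *)
Definition foot x y (c : V3) : option 'I_n :=
  match c with
  | inl (inr m) => Some m
  | inl (inl k) => if mate x (inl k) is inr m then Some m else None
  | inr k => if mate y (inr k) is inl m then Some m else None
  end.

Lemma glue_middle x y a b :
  adj (glue x y) (inl (inr a)) (inl (inr b)) = middle x y a b.
Proof.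
apply/glue_adjP/orP => [[[u [[<-] [/eqP]]]|[[u|u] [//= [<-]]]]|[|] /eqP E].
- by rewrite eq_sym; left.
- by case E: mate => //= -[->]; right.
- by left; exists (inr a); rewrite E.
by right; exists (inl a); rewrite E.
Qed.

(** An edge between an outer column and the middle one fixes the foot, an edge inside the middle
    column moves it along [middle], and an edge inside an outer column has no foot at either end. *)
Lemma foot_adj x y c d : adj (glue x y) c d ->
  match foot x y c, foot x y d with
  | Some m, Some m' => connect (middle x y) m m'
  | None, None => true
  | _, _ => false
  end.
Proof.
case/glue_adjP=> -[[k|k] [-> ->]] /=.
- by case E: mate => [j|j] /=; rewrite ?connect0 // -E mateK.
- case E: mate => [j|j] /=; first by rewrite -E mateK connect0.
  by apply: connect1; rewrite /middle E eqxx.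
- case E: mate => [j|j] /=; last by rewrite -E mateK connect0.
  by apply: connect1; rewrite /middle E eqxx orbT.
by case E: mate => [j|j] /=; rewrite ?connect0 // -E mateK.
Qed.

Lemma foot_connect x y c d : connect (adj (glue x y)) c d ->
  match foot x y c, foot x y d with
  | Some m, Some m' => connect (middle x y) m m'
  | None, None => true
  | _, _ => false
  end.
Proof.
case/connectP=> q; elim: q c => [|c' q IH] c /= => [_ ->|/andP[/foot_adj cc' qP] dE].
  by case: foot.
move: cc' (IH _ qP dE).
case: (foot x y c) => [m|]; case: (foot x y c') => [m'|] //.
by case: (foot x y d) => // m''; apply: connect_trans.
Qed.

Lemma foot_glue x y c m : foot x y c = Some m ->
  connect (adj (glue x y)) c (inl (inr m)).
Proof.
case: c => [[k|k]|k] /=.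
- case E: mate => [j|j] // [<-]; apply/connect1/glue_adjP; left.
  by exists (inl k); rewrite E.
- by case=> ->; apply: connect0.
case E: mate => [j|j] // [<-]; apply/connect1/glue_adjP; right.
by exists (inr k); rewrite E.
Qed.

Lemma connect_foot x y c d m m' : foot x y c = Some m -> foot x y d = Some m' ->
  connect (adj (glue x y)) c d = connect (middle x y) m m'.
Proof.
move=> cm dm; apply/idP/idP => [/foot_connect|mm']; first by rewrite cm dm.
apply: connect_trans (foot_glue cm) _; rewrite adj_connect_sym.
apply: connect_trans (foot_glue dm) _; rewrite adj_connect_sym.
apply: (connect_homo (k := fun a => inl (inr a) : V3)) mm' => a b.
by rewrite -glue_middle; apply: connect1.
Qed.

Lemma mate_compose x y u v m m' : v != u ->
  foot x y (glue_outer u) = Some m -> foot x y (glue_outer v) = Some m' ->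
  (mate (compose x y) u == v) = connect (middle x y) m m'.
Proof.
move=> vu um vm; rewrite -(connect_foot um vm) compose_connect.
by rewrite !inE (negPf vu) eq_sym.
Qed.

Lemma mate_compose_arc x y a b : mate x (inl a) = inl b ->
  mate (compose x y) (inl a) = inl b.
Proof.
move=> ab; apply/esym/eqP; have := compose_connect x y (inl a) (inl b).
rewrite !inE -ab (negPf (mate_neq _ _)) /= ab => <-.
by apply/connect1/glue_adjP; left; exists (inl a); rewrite ab.
Qed.

(** A through line of the product enters the middle column by a through edge of [x], runs along
    [middle], and leaves by a through edge of [y]. *)
Lemma through_composeP x y a :
  reflect (exists2 m, mate x (inl a) = inr m &
             exists2 m', m' \in through_vertices y & connect (middle x y) m m')
          (a \in through_vertices (compose x y)).
Proof.
rewrite inE; apply: (iffP idP) => [|[m am [m' my mm']]]; last first.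
  move: my; rewrite inE; case E: mate => [|b] //= _.
  suff /eqP-> : mate (compose x y) (inl a) == inr b by [].
  rewrite (@mate_compose _ _ _ _ m m') //= ?am //.
  by rewrite -E mateK.
case am: (mate x (inl a)) => [b|m]; first by rewrite (mate_compose_arc _ am).
case E: (mate (compose x y) (inl a)) => [|b] //= _; exists m => //.
have := compose_connect x y (inl a) (inr b); rewrite E !inE eqxx orbT.
move/foot_connect; rewrite /= am.
case bm: (mate y (inr b)) => [m'|] // mm'; exists m' => //.
by rewrite inE -bm mateK.
Qed.

Lemma middle_eqr x y y' :
  (forall a b, (mate y (inl a) == inl b) = (mate y' (inl a) == inl b)) ->
  middle x y =2 middle x y'.
Proof. by move=> h a b; rewrite /middle h. Qed.

(** Paths between two left vertices meet [y] only in its left arcs. This makes the left state of a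
    product independent of [s2] and [q2]. *)
Lemma mate_compose_eqr x y y' :
  (forall a b, (mate y (inl a) == inl b) = (mate y' (inl a) == inl b)) ->
  forall a b, (mate (compose x y) (inl a) == inl b) =
              (mate (compose x y') (inl a) == inl b).
Proof.
move=> h a b; case am: (mate x (inl a)) => [c|m].
  by rewrite !(mate_compose_arc _ am).
case bm: (mate x (inl b)) => [c|m'].
  (* The arc of [x] at [b] survives in the product, so joining [a] to [b] would force [a = c],
     against [am]. *)
  have no z : (mate (compose x z) (inl a) == inl b) = false.
    apply/eqP=> E; have := mate_compose_arc z bm; rewrite -E mateK => -[ac].
    by have := mateK x (inl b); rewrite bm -ac am.
  by rewrite !no.
have [->|ab] := eqVneq b a; first by rewrite !(negPf (mate_neq _ _)).
rewrite !(@mate_compose _ _ _ _ m m') //= ?am ?bm //.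
exact/eq_connect/middle_eqr.
Qed.

Definition reverse (c : V3) : V3 :=
  match c with
  | inl (inl k) => inr k | inl (inr k) => inl (inr k) | inr k => inl (inl k)
  end.

Lemma reverseK : involutive reverse. Proof. by case=> [[|]|]. Qed.

Lemma adj_glue_flip x y c d :
  adj (glue (flip y) (flip x)) (reverse c) (reverse d) = adj (glue x y) c d.
Proof.
have rl u : reverse (inl u) = glue_right (swap u) by case: u.
have rr u : reverse (glue_right u) = inl (swap u) by case: u.
have imp x' y' c' d' : adj (glue x' y') c' d' ->
    adj (glue (flip y') (flip x')) (reverse c') (reverse d').
  case/glue_adjP=> -[u [-> ->]]; apply/glue_adjP; [right|left]; exists (swap u);
  by rewrite mate_flip swapK ?rl ?rr.
apply/idP/idP; last exact: imp.
by move/imp; rewrite !flipK !reverseK.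
Qed.

(** This turns statements about left states of products into statements about right states. *)
Lemma compose_flip x y : compose (flip y) (flip x) = flip (compose x y).
Proof.
have ro u : reverse (glue_outer u) = glue_outer (swap u) by case: u.
apply: mate_inj => u; rewrite mate_flip; apply/esym/eqP.
set v := mate (compose x y) (swap u).
have vu : swap v != u by rewrite (can2_eq (@swapK n) (@swapK n)) mate_neq.
have := compose_connect (flip y) (flip x) u (swap v).
rewrite !inE (negPf vu) => /= <-; rewrite -[u](@swapK n) -(ro v) -(ro (swap u)).
have : connect (adj (glue x y)) (glue_outer (swap u)) (glue_outer v).
  by rewrite compose_connect !inE eqxx orbT.
apply: (connect_homo (k := reverse)) => c d; rewrite -adj_glue_flip.
exact: connect1.
Qed.

Lemma nloops_flip x y : nloops (flip y) (flip x) = nloops x y.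
Proof.
have cr c : (reverse c \in codom (@glue_outer n)) = (c \in codom (@glue_outer n)).
  have imp d : d \in codom (@glue_outer n) -> reverse d \in codom (@glue_outer n).
    by case/codomP=> -[k|k] ->; [apply: (codom_f _ (inr k))|apply: (codom_f _ (inl k))].
  by apply/idP/idP => /imp; rewrite ?reverseK.
rewrite !nloopsE; apply: (card_inner_embed (inv_inj (@reverseK))).
- by move=> c d; apply: adj_glue_flip.
- by move=> c; rewrite !inE cr.
- by move=> c d _ _; rewrite -(reverseK d) codom_f.
move=> c cI _; rewrite -(reverseK c); apply: imset_f.
by move: cI; rewrite !inE cr.
Qed.

(** A closed loop consists of middle vertices whose edges on both sides stay in the middle column;
    from such a vertex no edge leads outside. *)
Lemma nloops_middle x y :
  nloops x y =
  #|inner (middle x y) [set m | is_inl (mate y (inl m)) && ~~ is_inl (mate x (inr m))]|.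
Proof.
rewrite nloopsE; apply: (card_inner_embed (i := fun m => inl (inr m))).
- by move=> a b [].
- exact: glue_middle.
- by move=> a _; rewrite inE; apply/negP=> /codomP[[]].
- move=> a b; rewrite inE => /andP[].
  case ya: (mate y (inl a)) => [j|] //= _; case xa: (mate x (inr a)) => [|k] //= _.
  case/glue_adjP=> -[u [+ ->]].
    by case=> <-; rewrite xa; apply: (codom_f (fun m => inl (inr m) : V3)).
  case: u => //= u [<-]; rewrite ya.
  exact: (codom_f (fun m => inl (inr m) : V3)).
case=> [[k|k]|k]; rewrite inE.
- by rewrite (codom_f (@glue_outer n) (inl k)).
- move=> _ kI; apply: imset_f; rewrite inE; apply/andP; split.
    case E: (mate y (inl k)) => [//|j].
    have /kI : adj (glue x y) (inl (inr k)) (inr j).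
      by apply/glue_adjP; right; exists (inl k); rewrite E.
    by rewrite inE (codom_f (@glue_outer n) (inr j)).
  case E: (mate x (inr k)) => [j|//].
  have /kI : adj (glue x y) (inl (inr k)) (inl (inl j)).
    by apply/glue_adjP; left; exists (inr k); rewrite E.
  by rewrite inE (codom_f (@glue_outer n) (inl j)).
by rewrite (codom_f (@glue_outer n) (inr k)).
Qed.

End Middle.

(** * Products of link diagrams *)

Section Rank.

Lemma sorted_enum_ord n (A : {set 'I_n}) : sorted (relpre val ltn) (enum A).
Proof.
rewrite {1}/enum_mem; apply: sorted_filter.
  by move=> i j k; apply: ltn_trans.
by rewrite -sorted_map -enumT val_enum_ord iota_ltn_sorted.
Qed.

(** Extends [defect] to arbitrary sets, so that ranks in a set of indices can be compared with ranks
    among the defects themselves. *)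
Definition ranked n t (A : {set 'I_n}) (h : #|A| = t) (j : 'I_t) : 'I_n :=
  enum_val (cast_ord (esym h) j).

Lemma ranked_homo n t (A : {set 'I_n}) (h : #|A| = t) :
  {homo ranked h : i j / i < j}.
Proof.
move=> i j ij; rewrite /ranked !(enum_val_nth (ranked h i)) /=.
apply: (sorted_ltn_nth _ _ (sorted_enum_ord A)) => //.
- by move=> a b c; apply: ltn_trans.
- by rewrite inE -cardE h.
by rewrite inE -cardE h.
Qed.

(** Both enumerations of [B] are strictly increasing with the same elements, hence equal. *)
Lemma ranked_imset m n t (f : 'I_m -> 'I_n) (A : {set 'I_m}) (B : {set 'I_n})
    (hA : #|A| = t) (hB : #|B| = t) (j : 'I_t) :
  {homo f : i j / i < j} -> B = f @: A -> ranked hB j = f (ranked hA j).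
Proof.
move=> fmono defB; have enumB : enum B = [seq f i | i <- enum A].
  apply: (@irr_sorted_eq _ (relpre val ltn)).
  - by move=> a b c; apply: ltn_trans.
  - by move=> a; apply: ltnn.
  - exact: sorted_enum_ord.
  - by apply: homo_sorted (sorted_enum_ord A) => a b; apply: fmono.
  by move=> b; rewrite mem_enum defB; apply/imsetP/mapP => -[a aA ->];
    exists a; rewrite // ?mem_enum // -mem_enum.
rewrite /ranked (enum_val_nth (ranked hB j)) (enum_val_nth (ranked hA j)) /=.
by rewrite enumB (nth_map (ranked hA j)) // -cardE hA.
Qed.

Lemma ranked_full n (A : {set 'I_n}) (h : #|A| = n) j : ranked h j = j.
Proof.
have AT : A = [set: 'I_n] by apply/eqP; rewrite eqEcard subsetT cardsT card_ord h leqnn.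
apply: val_inj; rewrite /ranked (enum_val_nth j) /=.
have -> : enum A = enum 'I_n by apply: eq_enum => i; rewrite AT inE.
by rewrite nth_enum_ord.
Qed.

End Rank.

Lemma eq_inner (T : finType) (r r' : rel T) (I : {set T}) :
  connect r =2 connect r' -> inner r I = inner r' I.
Proof.
move=> rr'; apply/setP=> K; apply/innerP/innerP => -[u -> uI]; exists u.
- by apply/setP=> v; rewrite !inE rr'.
- by move=> v; rewrite -rr'; apply: uI.
- by apply/setP=> v; rewrite !inE rr'.
by move=> v; rewrite rr'; apply: uI.
Qed.

Lemma loopsE (T : finType) (g : seq {set T}) :
  loops g = inner (adj g) [set v | degree g v == 2].
Proof.
apply/setP=> K; rewrite !inE; congr (_ && _).
by apply/forall_inP/subsetP => h v /h; rewrite inE.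
Qed.

Section Through.
Variable n : nat.

Lemma defectE t (p : link_state n t) (i : 'I_t) :
  defect p i = ranked (card_defects p) i.
Proof. by []. Qed.

Lemma defect_homo t (p : link_state n t) : {homo defect p : i j / i < j}.
Proof. exact: ranked_homo. Qed.

Lemma defect_in t (p : link_state n t) i : defect p i \in defects p.
Proof. by apply/defectP; exists i. Qed.

Lemma degree_arcs t (p : link_state n t) k :
  count (fun B : {set 'I_n} => k \in B) (enum (arcs p)) = (k \notin defects p).
Proof.
case: (link_arc p k) => [[k' pk ->]|/defectP[i ->]]; last first.
  rewrite defect_in; apply/eqP; rewrite -leqn0 leqNgt -has_count.
  by apply/hasPn=> B; rewrite mem_enum => /(arc_defect i)/negPf->.
have := count_uniq_mem [set k; k'] (enum_uniq (arcs p)).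
rewrite mem_enum pk => <-; apply: eq_in_count => B; rewrite mem_enum => pB /=.
apply/idP/eqP => [kB|->]; last exact: set21.
move: pB pk; rewrite !inE => /andP[pB _] /andP[pk _].
exact: link_uniq pB pk kB (set21 _ _).
Qed.

(** Represents each path counted by [pair_set] by its end at a defect of [q]. *)
Definition through t1 t2 (q : link_state n t1) (p : link_state n t2) : {set 'I_n} :=
  [set m in defects q |
    [exists m' in defects p, connect (adj (pair_graph q p)) m m']].

(* For every p1, the defects of p1 which survive in a product (p1, s, q)(p, _, _)
   are those indexed by [kept s q p]. *)
Definition kept t1 t2 (s : Sigma t1) (q : link_state n t1) (p : link_state n t2) :
    {set 'I_t1} :=
  [set k | defect q ((s : 'S_t1)^-1%g k) \in through q p].

Lemma card_kept t1 t2 (s : Sigma t1) (q : link_state n t1) (p : link_state n t2) :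
  #|kept s q p| = #|through q p|.
Proof.
have dI : injective (fun k => defect q ((s : 'S_t1)^-1%g k)).
  by move=> i j /defect_inj/perm_inj.
rewrite -(card_imset _ dI); congr #|pred_of_set _|; apply/setP=> m.
apply/imsetP/idP => [[k + ->]|mt]; first by rewrite [k \in _]inE.
have /setIdP[/defectP[i mE] _] := mt.
by exists ((s : 'S_t1) i); rewrite ?[_ i \in _]inE permK -?mE.
Qed.

Section Product.
Variables (t1 t2 : nat) (p1 q1 : link_state n t1) (s1 : Sigma t1).
Variables (p2 q2 : link_state n t2) (s2 : Sigma t2).
Local Notation x := (link_diagram p1 s1 q1).
Local Notation y := (link_diagram p2 s2 q2).

Lemma middle_link : middle x y =2 adj (pair_graph q1 p2).
Proof.
move=> a b; rewrite /middle /adj mem_cat !mem_enum.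
by rewrite mate_link_inr mate_link_inl.
Qed.

Lemma connect_middle_link :
  connect (middle x y) =2 connect (adj (pair_graph q1 p2)).
Proof. exact: eq_connect middle_link. Qed.

(** The defect of index [k] of [p1] enters the middle column at the defect of index [s1^-1 k] of
    [q1], and survives if the pair graph leads from there to a defect of [p2]. *)
Lemma through_product :
  through_vertices (compose x y) = defect p1 @: kept s1 q1 p2.
Proof.
apply/setP=> a; apply/through_composeP/imsetP => [[m am [m' my mm']]|[k kK ->]].
  have: a \in through_vertices x by rewrite inE am.
  rewrite through_link => /defectP[k aE]; exists k => //.
  move: am; rewrite aE mate_link_defect_inlV => -[mE].
  rewrite !inE mE -mE; rewrite through_link in my.
  apply/andP; split; first by have := defect_in q1 ((s1 : 'S_t1)^-1%g k); rewrite inE.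
  by apply/exists_inP; exists m'; rewrite // mE -connect_middle_link.
exists (defect q1 ((s1 : 'S_t1)^-1%g k)); first by rewrite mate_link_defect_inlV.
move: kK; rewrite inE => /setIdP[_ /exists_inP[m' pm' mm']].
by exists m'; rewrite ?through_link ?connect_middle_link.
Qed.

Lemma card_through_product : #|through_vertices (compose x y)| = #|through q1 p2|.
Proof. by rewrite through_product card_imset ?card_kept //; apply: defect_inj. Qed.

(** A middle vertex has both edges in the middle column exactly when it is a defect of neither [q1]
    nor [p2], that is, when its degree in the pair graph is 2. *)
Lemma nloops_product : nloops x y = #|loops (pair_graph q1 p2)|.
Proof.
rewrite nloops_middle (eq_inner _ connect_middle_link) loopsE.
congr #|pred_of_set (inner _ _)|; apply/setP=> k; rewrite !inE.
have -> : is_inl (mate y (inl k)) = (k \notin defects p2).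
  by rewrite -(through_link p2 q2 s2) inE negbK.
have -> : is_inl (mate x (inr k)) = (k \in defects q1).
  rewrite -(through_link q1 p1 ((s1 : 'S_t1)^-1)%g) -flip_link inE mate_flip /=.
  by case: mate.
by rewrite /degree /pair_graph count_cat !degree_arcs; do 2!case: (_ \in _).
Qed.

Lemma mate_product_defects k l :
  (mate (compose x y) (inr (defect q2 l)) == inl (defect p1 k)) =
  connect (adj (pair_graph q1 p2))
    (defect q1 ((s1 : 'S_t1)^-1%g k)) (defect p2 ((s2 : 'S_t2) l)).
Proof.
rewrite (can2_eq (mateK _) (mateK _)) eq_sym -connect_middle_link.
apply: mate_compose => //=; first by rewrite mate_link_defect_inlV.
by rewrite mate_link_defect_inr.
Qed.

End Product.

(** Connectedness is read off as a mate in an auxiliary product with trivial permutations, and mates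
    are unique. *)
Lemma defect_connect_uniq t1 t2 (q : link_state n t1) (p : link_state n t2) i j k :
  connect (adj (pair_graph q p)) (defect q i) (defect p k) ->
  connect (adj (pair_graph q p)) (defect q j) (defect p k) -> i = j.
Proof.
have E l : connect (adj (pair_graph q p)) (defect q l) (defect p k) =
   (mate (compose (link_diagram q (1%g : 'S_t1) q) (link_diagram p (1%g : 'S_t2) p))
      (inr (defect p k)) == inl (defect q l)).
  by rewrite mate_product_defects invg1 !perm1.
by rewrite !E => /eqP-> /eqP[/defect_inj].
Qed.

Lemma through_flip_product t1 t2 (p1 q1 : link_state n t1) (s1 : Sigma t1)
    (p2 q2 : link_state n t2) (s2 : Sigma t2) :
  through_vertices
    (flip (compose (link_diagram p1 s1 q1) (link_diagram p2 s2 q2))) =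
  defect q2 @: kept ((s2 : 'S_t2)^-1%g : Sigma t2) p2 q1.
Proof. by rewrite -compose_flip !flip_link through_product. Qed.

(** Both sides count the through lines of one product, seen from its two outer columns. *)
Lemma card_through_sym t1 t2 (q : link_state n t1) (p : link_state n t2) :
  #|through p q| = #|through q p|.
Proof.
rewrite -(card_through_product q q (1%g : 'S_t1) p p (1%g : 'S_t2)).
by rewrite -card_through_flip -compose_flip !flip_link card_through_product.
Qed.

Lemma card_through_le t1 t2 (q : link_state n t1) (p : link_state n t2) :
  #|through q p| <= t1.
Proof.
rewrite -{2}(card_defects q); apply: subset_leq_card.
by apply/subsetP=> m /setIdP[].
Qed.

(** The defect of rank [j] of the product is the defect of [p1] whose index has rank [j] in [kept],
    because [defect p1] is increasing; likewise on the right. The resulting criterion mentions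
    neither [p1] nor [q2]. *)
Lemma permutation_product t t1 t2 (p1 q1 : link_state n t1) (s1 : Sigma t1)
    (p2 q2 : link_state n t2) (s2 : Sigma t2) (p q : link_state n t) (s : Sigma t)
    (h1 : #|kept s1 q1 p2| = t)
    (h2 : #|kept ((s2 : 'S_t2)^-1%g : Sigma t2) p2 q1| = t) (i j : 'I_t) :
  compose (link_diagram p1 s1 q1) (link_diagram p2 s2 q2) = link_diagram p s q ->
  ((s : 'S_t) i == j) =
  connect (adj (pair_graph q1 p2))
    (defect q1 ((s1 : 'S_t1)^-1%g (ranked h1 j)))
    (defect p2 ((s2 : 'S_t2) (ranked h2 i))).
Proof.
move=> E; rewrite -(mate_product_defects p1 q1 s1 p2 q2 s2) E.
have -> : defect q2 (ranked h2 i) = defect q i.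
  rewrite defectE; apply/esym/ranked_imset; first exact: defect_homo.
  by rewrite -(through_flip_product p1 q1 s1) E flip_link through_link.
have -> : defect p1 (ranked h1 j) = defect p j.
  rewrite defectE; apply/esym/ranked_imset; first exact: defect_homo.
  by rewrite -(through_product p1 q1 s1 p2 q2 s2) E through_link.
rewrite mate_link_defect_inr (inj_eq inl_inj).
by rewrite (inj_eq (@defect_inj _ _ p)).
Qed.

Lemma permutation_product_unique t t1 t2 (p1 p1' q1 : link_state n t1) (s1 : Sigma t1)
    (p2 q2 q2' : link_state n t2) (s2 : Sigma t2) (p p' q q' : link_state n t)
    (s s' : Sigma t) :
  compose (link_diagram p1 s1 q1) (link_diagram p2 s2 q2) = link_diagram p s q ->
  compose (link_diagram p1' s1 q1) (link_diagram p2 s2 q2') = link_diagram p' s' q' ->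
  s = s'.
Proof.
move=> E E'.
have ht : #|through q1 p2| = t.
  by rewrite -(card_through_product p1 q1 s1 p2 q2 s2) E through_link card_defects.
have h1 : #|kept s1 q1 p2| = t by rewrite card_kept.
have h2 : #|kept ((s2 : 'S_t2)^-1%g : Sigma t2) p2 q1| = t.
  by rewrite card_kept card_through_sym.
apply/permP=> i; apply/eqP.
by rewrite (permutation_product h1 h2 i _ E) -(permutation_product h1 h2 i _ E').
Qed.

(** When every defect on the right survives, ranks are the indices themselves, and evaluating at
    [s2^-1 k] removes [s2] from the criterion of [permutation_product]. *)
Lemma permutation_product_full t1 t2 (p1 q1 : link_state n t1) (s1 : Sigma t1)
    (p2 q2 : link_state n t2) (s2 s2' : Sigma t2) (p p' q q' : link_state n t2)
    (s s' : Sigma t2) :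
  compose (link_diagram p1 s1 q1) (link_diagram p2 s2 q2) = link_diagram p s q ->
  compose (link_diagram p1 s1 q1) (link_diagram p2 s2' q2) = link_diagram p' s' q' ->
  (s * (s2 : Sigma t2)^-1 = s' * (s2' : Sigma t2)^-1)%g.
Proof.
move=> E E'.
have ht : #|through q1 p2| = t2.
  by rewrite -(card_through_product p1 q1 s1 p2 q2 s2) E through_link card_defects.
have h1 : #|kept s1 q1 p2| = t2 by rewrite card_kept.
have h2 (u : Sigma t2) : #|kept u p2 q1| = t2 by rewrite card_kept card_through_sym.
(* The product of [Sigma] applies its right factor first. *)
apply/permP=> k; rewrite !permM; apply/eqP.
rewrite (permutation_product h1 (h2 _) _ _ E) ranked_full permKV.
have := permutation_product h1 (h2 _) ((s2' : 'S_t2)^-1%g k) _ E'.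
by rewrite ranked_full permKV => <-.
Qed.

(** After reflection, [q2] is the left state of the first factor: its arcs persist, and no defect is
    lost. *)
Lemma right_state_full t1 t2 (p1 q1 : link_state n t1) (s1 : Sigma t1)
    (p2 q2 : link_state n t2) (s2 : Sigma t2) (p q : link_state n t2) (s : Sigma t2) :
  compose (link_diagram p1 s1 q1) (link_diagram p2 s2 q2) = link_diagram p s q ->
  q = q2.
Proof.
move/(congr1 (@flip n)); rewrite -compose_flip !flip_link.
set x := link_diagram q2 _ _; set y := link_diagram q1 _ _ => E.
(* Through vertices of a product are through vertices of its first factor; equal cardinalities make
   the inclusion an equality. *)
have thE : through_vertices (compose x y) = defects q2.
  apply/eqP; rewrite eqEcard [in X in _ && X]E through_link !card_defects leqnn.
  rewrite andbT -(through_link q2 p2 ((s2 : 'S_t2)^-1)%g).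
  by apply/subsetP=> a /through_composeP[m am _]; rewrite inE am.
apply: val_inj => /=.
rewrite -(left_parts_link q p ((s : 'S_t2)^-1)%g) -E -(left_parts_link q2 p2 ((s2 : 'S_t2)^-1)%g).
apply: left_parts_eq => a b; rewrite -/x.
case am: (mate x (inl a)) => [c|m]; first by rewrite (mate_compose_arc _ am).
have : a \in through_vertices x by rewrite inE am.
by rewrite through_link -thE inE; case: mate.
Qed.

(** Sending a surviving defect of [q] to its component is injective, because a defect of [p] is
    connected to at most one defect of [q]. The component is not a loop, since a defect has degree
    at most 1. *)
Lemma card_pair_set t1 t2 (q : link_state n t1) (p : link_state n t2) :
  #|pair_set q p| = #|through q p|.
Proof.
pose cls m := [set v | connect (adj (pair_graph q p)) m v].
have clsI : {in through q p &, injective cls}.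
  move=> m m' /setIdP[/defectP[i ->] /exists_inP[_ /defectP[k ->] ik]].
  case/setIdP=> /defectP[j ->] _ /setP/(_ (defect p k)); rewrite !inE ik => /esym jk.
  by rewrite (defect_connect_uniq ik jk).
rewrite -(card_in_imset clsI); congr #|pred_of_set _|; apply/setP=> K.
rewrite inE; apply/and4P/imsetP.
  case=> /componentsP[u ->] _ /exists_inP[m]; rewrite inE => um mq.
  case/exists_inP=> m'; rewrite inE => um' mp'; exists m.
    rewrite inE mq; apply/exists_inP; exists m' => //.
    by rewrite -(same_connect (@adj_connect_sym _ _) um).
  by apply/setP=> v; rewrite !inE (same_connect (@adj_connect_sym _ _) um).
case=> m /setIdP[mq /exists_inP[m' mp' mm']] ->; split.
- by apply/componentsP; exists m.
- rewrite loopsE; apply/negP=> /innerP[u uE uI].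
  have : m \in cls m by rewrite inE.
  rewrite uE inE => /uI; rewrite inE /degree /pair_graph count_cat !degree_arcs mq.
  by case: (_ \in _).
- by apply/exists_inP; exists m; rewrite // inE connect0.
by apply/exists_inP; exists m'; rewrite // inE.
Qed.

End Through.

(** * The Brauer algebra *)

Section ProductData.
Variable n : nat.

Section Label.
Variables (t1 t2 : nat) (q : link_state n t1) (p : link_state n t2).

Lemma through_ltnS : #|through q p| < n.+1.
Proof. by rewrite ltnS -[leqRHS]card_ord max_card. Qed.

(** A product built on [q] and [p] has a left state with this number of defects. *)
Lemma through_parity : ~~ odd (n - Ordinal through_ltnS).
Proof.
exact: link_state_parity
  (left_state (card_through_product q q (1%g : 'S_t1) p p (1%g : 'S_t2))).
Qed.

Definition product_label : brauer_index n := BrauerIndex through_parity.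

End Label.

Lemma card_through_flip_product t1 t2 (p1 q1 : link_state n t1) (s1 : Sigma t1)
    (p2 q2 : link_state n t2) (s2 : Sigma t2) :
  #|through_vertices (flip (compose (link_diagram p1 s1 q1) (link_diagram p2 s2 q2)))|
  = #|through q1 p2|.
Proof. by rewrite card_through_flip card_through_product. Qed.

Section Components.
Variables (t1 t2 : nat) (p1 : link_state n t1) (s1 : Sigma t1) (q1 : link_state n t1).
Variables (p2 : link_state n t2) (s2 : Sigma t2) (q2 : link_state n t2).

(** The second factor is completed by [p2] and the trivial permutation, so that [s2] and [q2] are
    not arguments; [mate_compose_eqr] shows that the choice is harmless. *)
Definition product_left : link_state n #|through q1 p2| :=
  left_state (card_through_product p1 q1 s1 p2 p2 (1%g : 'S_t2)).

Definition product_right : link_state n #|through q1 p2| :=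
  left_state (card_through_flip_product p1 q1 s1 p2 q2 s2).

End Components.

(* The permutation does not depend on p1 and q2, so q1 and p2 serve in their place. *)
Definition product_sigma t1 t2 (s1 : Sigma t1) (q1 : link_state n t1)
    (p2 : link_state n t2) (s2 : Sigma t2) : Sigma #|through q1 p2| :=
  odflt (1%g : 'S_#|through q1 p2|) [pick s : 'S_#|through q1 p2| |
    compose (link_diagram q1 s1 q1) (link_diagram p2 s2 p2) ==
    link_diagram (product_left q1 s1 q1 p2) s (product_right q1 s1 q1 p2 s2 p2)].

Lemma compose_link t1 t2 (p1 q1 : link_state n t1) (s1 : Sigma t1)
    (p2 q2 : link_state n t2) (s2 : Sigma t2) :
  compose (link_diagram p1 s1 q1) (link_diagram p2 s2 q2) =
  link_diagram (product_left p1 s1 q1 p2) (product_sigma s1 q1 p2 s2)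
    (product_right p1 s1 q1 p2 s2 q2).
Proof.
have ex (p q' : link_state n t1) (p' q : link_state n t2) :
    exists s, compose (link_diagram p s1 q') (link_diagram p' s2 q) =
      link_diagram (product_left p s1 q' p') s (product_right p s1 q' p' s2 q).
  have leftE : product_left p s1 q' p' =
      left_state (card_through_product p q' s1 p' q s2).
    apply: val_inj; apply: left_parts_eq; apply: mate_compose_eqr => a b.
    by rewrite !mate_link_inl.
  have [s sE] := link_decomposition (card_through_product p q' s1 p' q s2)
                   (card_through_flip_product p q' s1 p' q s2).
  by exists s; rewrite leftE; exact: sE.
have [s E] := ex p1 q1 p2 q2; rewrite E; congr link_diagram.
(* The permutation was picked for other outer link states; uniqueness identifies it with [s]. *)
rewrite /product_sigma; case: pickP => [s' /eqP E'|no] /=.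
  exact: permutation_product_unique E E'.
by have [s' /eqP E'] := ex q1 q1 p2 p2; have := no s'; rewrite E'.
Qed.

End ProductData.

Section Cast.
Variable n : nat.

(** [diagram_like] compares objects over equal labels through [eq_rect]; transporting the whole
    triple keeps the diagram. *)
Lemma link_diagram_cast (l l' : brauer_index n) (e : l = l') (p q : brauer_links l)
    (s : brauer_group l) :
  link_diagram (p : link_state n l) s q =
  link_diagram (eq_rect l (@brauer_links n) p l' e : link_state n l')
    (eq_rect l (@brauer_group n) s l' e) (eq_rect l (@brauer_links n) q l' e).
Proof. by case: _ / e. Qed.

End Cast.

Local Open Scope ring_scope.

(** * The basis, the anti-involution and the product formula *)

Section BrauerBasis.
Variables (R : comNzRingType) (n : nat) (delta : R).
Local Notation A := (brauer n delta).
Local Notation dvec := (@dvec R n delta).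

Lemma dvec_inj : injective dvec.
Proof.
move=> x y /(congr1 (fun f : A => coeff f x)); rewrite !coeff_dvec eqxx.
by case: eqP => // _ /eqP; rewrite oner_eq0.
Qed.

Lemma link_diagram_surj (x : diagram n) :
  exists z : {l : brauer_index n & (brauer_links l * brauer_group l * brauer_links l)%type},
    dvec x = C_total (@brauer_C n R delta) z.
Proof.
have le : (#|through_vertices x| < n.+1)%N by rewrite ltnS -[leqRHS]card_ord max_card.
have [s xE] := link_decomposition (erefl #|through_vertices x|) (card_through_flip x).
have par : ~~ odd (n - Ordinal le) :=
  link_state_parity (left_state (erefl #|through_vertices x|)).
exists (existT _ (BrauerIndex par)
  (left_state (erefl _), s, left_state (card_through_flip x))).
by rewrite /= /brauer_C /= {1}xE.
Qed.

(** A diagram gives back the label as its number of through vertices, then its two link states, then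
    the permutation from the mates of the right defects. *)
Lemma brauer_C_inj : injective (C_total (@brauer_C n R delta)).
Proof.
move=> [l [[p s] q]] [l' [[p' s'] q']] /= /dvec_inj E.
have ll' : l = l'.
  apply: val_inj; apply: val_inj => /=.
  by rewrite -(card_defects p) -(through_link p q s) E through_link card_defects.
case: _ / ll' in p' s' q' E *.
have pE : p = p' by apply: val_inj; rewrite /= -(left_parts_link p q s) E left_parts_link.
have qE : q = q'.
  apply: val_inj; rewrite /= -(left_parts_link q p ((s : 'S_l)^-1)%g) -flip_link E.
  by rewrite flip_link left_parts_link.
subst p' q'; suff -> : s = s' by []; apply/permP=> i.
have := mate_link_defect_inr p q s i.
by rewrite E mate_link_defect_inr => -[/defect_inj].
Qed.

Lemma brauer_C_basis :
  is_basis (fun a : A => exists z, a = C_total (@brauer_C n R delta) z).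
Proof.
have CdvecP a : (exists z, a = C_total (@brauer_C n R delta) z) ->
    exists x, a = dvec x.
  by case=> -[l [[p s] q]] ->; exists (link_diagram p s q).
split=> [s c us sC s0 a sa|f].
  have [x aE] := CdvecP _ (sC _ sa).
  (* Only the term of [dvec x] contributes to the coefficient at [x]. *)
  have := congr1 (fun f : A => coeff f x) s0; rewrite /= coeff0.
  rewrite (bigD1_seq a) //= coeffD coeffZ aE coeff_dvec eqxx mulr1.
  suff -> : coeff (\sum_(i <- s | i != dvec x) c i *: i) x = 0 by rewrite addr0.
  rewrite big_seq_cond; apply: (big_ind (fun f : A => coeff f x = 0)) => [|f g fx gx|b].
  - exact: coeff0.
  - by rewrite coeffD fx gx addr0.
  case/andP=> /sC/CdvecP[y ->] yx; rewrite coeffZ coeff_dvec.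
  by case: eqP => [xy|_]; [rewrite xy eqxx in yx|rewrite mulr0].
exists [seq dvec x | x <- enum {: diagram n}].
(* Coefficients are indexed by elements of the algebra, so the diagram is recovered from its basis
   vector; off the basis the value is 0. *)
exists (fun a => if [pick x | a == dvec x] is Some x then coeff f x else 0); split.
  by move=> _ /mapP[x _ ->]; apply: link_diagram_surj.
rewrite big_map big_enum [f in LHS]brauer_sum; apply: eq_bigr => x _.
case: pickP => [y /eqP/dvec_inj->//|/(_ x)].
by rewrite eqxx.
Qed.

Local Notation star := (@brauer_star n R delta).

Lemma brauer_star_linear : linear star.
Proof.
move=> a f g; rewrite /brauer_star scaler_sumr -big_split; apply: eq_bigr => x _.
by rewrite /= coeffD coeffZ scalerDl scalerA.
Qed.

Lemma coeff_star f x : coeff (star f) x = coeff f (flip x).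
Proof.
rewrite /brauer_star coeff_sum (bigD1 (flip x)) //= big1 => [|y yx].
  by rewrite coeffZ coeff_dvec flipK eqxx mulr1 addr0.
rewrite coeffZ coeff_dvec; case: eqP => [xy|_]; last by rewrite mulr0.
by rewrite xy flipK eqxx in yx.
Qed.

Lemma brauer_starK : involutive star.
Proof. by move=> f; apply: coeffP => x; rewrite !coeff_star flipK. Qed.

Lemma brauer_star_dvec x : star (dvec x) = dvec (flip x).
Proof.
apply: coeffP => y; rewrite coeff_star !coeff_dvec.
by rewrite (can2_eq (@flipK n) (@flipK n)).
Qed.

Lemma brauer_star0 : star 0 = 0.
Proof. by apply: coeffP => x; rewrite coeff_star !coeff0. Qed.

Lemma brauer_starZ a f : star (a *: f) = a *: star f.
Proof. by rewrite -[a *: f]addr0 brauer_star_linear brauer_star0 addr0. Qed.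

Lemma brauer_starD f g : star (f + g) = star f + star g.
Proof. by rewrite -[f]scale1r brauer_star_linear !scale1r. Qed.

Lemma brauer_starM (f g : A) : star (f * g) = star g * star f.
Proof.
rewrite -[f * g]/(brauer_mul f g) -[RHS]/(brauer_mul (star g) (star f)) /brauer_mul.
transitivity (\sum_x \sum_y (coeff f x * coeff g y) *: dmul delta (flip y) (flip x)).
  rewrite (big_morph star brauer_starD brauer_star0); apply: eq_bigr => x _.
  rewrite (big_morph star brauer_starD brauer_star0); apply: eq_bigr => y _.
  by rewrite /dmul !brauer_starZ brauer_star_dvec nloops_flip compose_flip.
(* Both sums on the right are reindexed by [flip]; commutativity of [R] then swaps the
   coefficients. *)
rewrite exchange_big [RHS](reindex_inj (inv_inj (@flipK n))) /=.
apply: eq_bigr => y _; rewrite [RHS](reindex_inj (inv_inj (@flipK n))) /=.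
by apply: eq_bigr => x _; rewrite !coeff_star !flipK mulrC.
Qed.

Lemma brauer_C_mul (t1 t2 : brauer_index n) (p1 q1 : link_state n t1) (s1 : Sigma t1)
    (p2 q2 : link_state n t2) (s2 : Sigma t2) :
  brauer_C delta p1 s1 q1 * brauer_C delta p2 s2 q2 =
  delta ^+ #|loops (pair_graph q1 p2)| *:
    @brauer_C n R delta (product_label q1 p2) (product_left p1 s1 q1 p2)
      (product_sigma s1 q1 p2 s2) (product_right p1 s1 q1 p2 s2 q2).
Proof.
rewrite /brauer_C -[LHS]/(brauer_mul _ _) brauer_mul_dvec /dmul nloops_product.
by rewrite compose_link.
Qed.

End BrauerBasis.

Theorem proposition3p6 (R : comNzRingType) (delta : R) (n : nat)
    (n_gt0 : (0 < n)%N) :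
  exists D : product_data R (@brauer_group n) (@brauer_links n),
    diagram_like (A := brauer n delta) (@brauer_C n R delta) (@brauer_star n R delta) D /\
    forall (t1 t2 : brauer_index n)
      (p1 q1 : link_state n t1) (s1 : Sigma t1)
      (p2 q2 : link_state n t2) (s2 : Sigma t2),
      let t := pd_label D (q1 : brauer_links t1) (p2 : brauer_links t2) in
      let p := pd_left D (p1 : brauer_links t1) (s1 : brauer_group t1) q1
                 (p2 : brauer_links t2) in
      let s := pd_sigma D (s1 : brauer_group t1) (q1 : brauer_links t1)
                 (p2 : brauer_links t2) (s2 : brauer_group t2) in
      let q := pd_right D (p1 : brauer_links t1) (s1 : brauer_group t1) q1
                 (p2 : brauer_links t2) (s2 : brauer_group t2) q2 in
      [/\ brauer_C delta p1 s1 q1 * brauer_C delta p2 s2 q2 =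
            delta ^+ #|loops (pair_graph q1 p2)| *: brauer_C delta p s q,
          compose (link_diagram p1 s1 q1) (link_diagram p2 s2 q2) =
            link_diagram p s q
        & t = t2 <-> #|pair_set q1 p2| = t2].
Proof.
pose D := @ProductData R _ _ (@brauer_group n) (@brauer_links n)
  (fun l1 l2 q1 p2 => delta ^+ #|loops (pair_graph q1 p2)|)
  (fun l1 l2 q1 p2 => product_label q1 p2)
  (fun l1 l2 p1 s1 q1 p2 => product_left p1 s1 q1 p2)
  (fun l1 l2 s1 q1 p2 s2 => product_sigma s1 q1 p2 s2)
  (fun l1 l2 p1 s1 q1 p2 s2 q2 => product_right p1 s1 q1 p2 s2 q2).
exists D; split; last first.
  move=> t1 t2 p1 q1 s1 p2 q2 s2 t p s q; split.
  - exact: brauer_C_mul.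
  - exact: compose_link.
  rewrite card_pair_set; split=> [tE|tE].
    exact: (congr1 (fun l : brauer_index n => l : nat) tE).
  by apply: val_inj; apply: val_inj.
split.
- exact: brauer_C_inj.
- exact: brauer_C_basis.
- exact: brauer_star_linear.
- exact: brauer_starK.
- exact: brauer_starM.
- by move=> l p q s; rewrite /brauer_C brauer_star_dvec flip_link.
- by move=> l1 l2 p1 q1 s1 p2 q2 s2; apply: brauer_C_mul.
- move=> l1 l2 q1 p2; split; first exact: card_through_le.
  by have := card_through_le p2 q1; rewrite card_through_sym.
- move=> l1 l2 p1 q1 s1 p2 q2 s2 e.
  have := compose_link p1 q1 s1 p2 q2 s2.
  rewrite (@link_diagram_cast n (product_label q1 p2) l2 e) => /right_state_full.
  by [].
move=> l1 l2 q1 s1 p2 s2 s2' e.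
(* [product_sigma] takes no outer link states, so [q1] and [p2] can serve as such. *)
have E := compose_link q1 q1 s1 p2 p2 s2.
have E' := compose_link q1 q1 s1 p2 p2 s2'.
rewrite (@link_diagram_cast n (product_label q1 p2) l2 e) in E.
rewrite (@link_diagram_cast n (product_label q1 p2) l2 e) in E'.
exact: permutation_product_full E E'.
Qed.
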